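(* Let $n\ge2$ and $s=(n-1,n)\in S_n$. The convex cone in $\mathbb R^{\{\nu\vdash n\}}$ generated by all vectors $\bigl(\operatorname{Tr}_{S^\nu}(a^*sa)\bigr)_{\nu\vdash n}$, where $a$ ranges over all of $\mathbb C[S_{n-1}]$ (arbitrary local filters in the one-swap architecture with block sizes $(n-1,1)$), is exactly the convex cone generated by the coefficient vectors of the branching-refined witnesses $$B_{\beta,\gamma}=\sum_{\nu}\frac{d_\nu}{c(\nu/\beta)-c(\beta/\gamma)},$$ where $\beta$ ranges over partitions of $n-1$, $\gamma$ ranges over partitions of $n-2$ obtained from $\beta$ by removing one box, and the sum is over all $\nu\vdash n$ obtained from $\beta$ by adding one box; that is, by the vectors whose $\nu$-entry is $1/(c(\nu/\beta)-c(\beta/\gamma))$ if $\nu$ is obtained from $\beta$ by adding one box and $0$ otherwise.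
   Context: $S^\nu$ is the irreducible complex $S_n$-module indexed by $\nu\vdash n$. $S_{n-1}\subset S_n$ fixes $n$. The involution $*$ on $\mathbb C[S_n]$ is conjugate-linear with $\sigma^*=\sigma^{-1}$. The content of a box in row $i$, column $j$ is $j-i$; $c(\nu/\beta)$ and $c(\beta/\gamma)$ denote the contents of the single added boxes, and the differences $c(\nu/\beta)-c(\beta/\gamma)$ occurring here are all nonzero. The symbol $d_\nu$ denotes the immanant $d_\nu(A)=\sum_{\sigma\in S_n}\chi^\nu(\sigma)\prod_i a_{i,\sigma(i)}$; coefficient vectors are taken with respect to the $d_\nu$, and a vector $(t_\nu)$ corresponds to the form $\sum_\nu t_\nu d_\nu$. *)

(* Defs.v *)
From HB Require Import structures.
From mathcomp Require Import all_boot all_order all_algebra all_fingroup.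
From mathcomp Require Import mxrepresentation complex.
From mathcomp Require Import boolp classical_sets functions reals.

Set Implicit Arguments.
Unset Strict Implicit.
Unset Printing Implicit Defensive.

Import GroupScope Order.TTheory GRing.Theory Num.Theory.
Local Open Scope ring_scope.

(** * Partitions and boxes *)

Definition is_partn (n : nat) (s : seq nat) : bool :=
  [&& sorted geq s, 0%N \notin s & sumn s == n].

Definition intpartn (n : nat) : Type := {s : seq nat | is_partn n s}.

(* Boxes (row, column) of a Young diagram, row by row.  Rows and columns are
   numbered from 0, which does not affect contents. *)
Definition boxes (s : seq nat) : seq (nat * nat) :=
  [seq (i, j) | i <- iota 0 (size s), j <- iota 0 (nth 0%N s i)].

Definition content (b : nat * nat) : int := b.2%:Z - b.1%:Z.

Definition skew_boxes (s t : seq nat) : seq (nat * nat) :=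
  [seq b <- boxes s | b \notin boxes t].

(* [s] is obtained from [t] by adding one box. *)
Definition adds_box (t s : seq nat) : bool :=
  all [in boxes s] (boxes t) && (size (skew_boxes s t) == 1%N).

(* Total content of [s / t]; when [adds_box t s], this is the content of the
   single box of [s / t]. *)
Definition skew_content (s t : seq nat) : int :=
  \sum_(b <- skew_boxes s t) content b.

(** * The group algebra of S_n

  The product of ['S_n] composes permutations from left to right:
  [(s * t) x = t (s x)].  The group algebra below is the one of this group; it
  is the opposite of the one obtained by composing from right to left. *)

Section GroupAlgebra.
Variables (C : numClosedFieldType) (n : nat).

Definition galg : Type := {ffun 'S_n -> C}.

Definition gadelta (s : 'S_n) : galg := [ffun g => (g == s)%:R].

Definition gamul (a b : galg) : galg :=
  [ffun g => \sum_(h : 'S_n) a h * b (h^-1 * g)%g].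

Definition gastar (a : galg) : galg := [ffun g => (a g^-1%g)^*].

Definition gaop (d : nat) (rG : mx_representation C [set: 'S_n]%G d)
    (a : galg) : 'M[C]_d :=
  \sum_(g : 'S_n) a g *: rG g.

End GroupAlgebra.

(* C[S_n] inside C[S_{n+1}], S_n being the stabilizer of the last point. *)
Definition in_sub_galg (C : numClosedFieldType) (n : nat)
    (a : galg C n.+1) : Prop :=
  forall g : 'S_n.+1, a g != 0 -> g ord_max = ord_max.

(** * Specht modules *)

Section Specht.
Variables (C : numClosedFieldType) (n : nat) (nu : intpartn n).

(* The box containing [k] in the tableau of shape [nu] filled row by row with
   0, ..., n-1. *)
Definition box_of (k : 'I_n) : nat * nat := nth (0%N, 0%N) (boxes (val nu)) k.

Definition row_group : {set 'S_n} :=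
  [set s : 'S_n | [forall k, (box_of (s k)).1 == (box_of k).1]].

Definition col_group : {set 'S_n} :=
  [set s : 'S_n | [forall k, (box_of (s k)).2 == (box_of k).2]].

(* Row symmetrizer times column antisymmetrizer, for right-to-left
   composition: in terms of the product of ['S_n], [p] after [q] is [q * p]. *)
Definition young_symmetrizer : galg C n :=
  \sum_(p in row_group) \sum_(q in col_group)
    [ffun g => (-1) ^+ odd_perm q * gadelta C (q * p)%g g].

(* Representations act on row vectors from the right.  The regular
   representation, [g] acting by [h |-> h * g] ([g] after [h]), is thus C[S_n]
   as a left module for right-to-left composition, and the Specht module
   is its submodule generated by the Young symmetrizer. *)
Definition galg_row (a : galg C n) : 'rV[C]_#|[set: 'S_n]| :=
  \sum_(g : 'S_n) a g *: delta_mx 0 (gring_index [set: 'S_n]%G g).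

Definition specht_repr :=
  submod_repr (cyclic_mx_module (regular_repr C [set: 'S_n]%G)
                 (galg_row young_symmetrizer)).

Definition specht_trace (a : galg C n) : C := \tr (gaop specht_repr a).

End Specht.

(** * Convex cones *)

Definition convex_cone (R : realType) (V : lmodType R) (G : set V) : set V :=
  [set v | exists (k : nat) (c : 'I_k -> R) (g : 'I_k -> V),
     [/\ forall i, 0 <= c i, forall i, G (g i) & v = \sum_i c i *: g i]].

(** * The two families of generators, for S_{n+2} *)

Section Generators.
Variables (R : realType) (n : nat).

Definition last_swap : 'S_n.+2 := tperm (inord n) ord_max.

Definition swap_trace (a : galg R[i] n.+2) (nu : intpartn n.+2) : R[i] :=
  specht_trace nu (gamul (gamul (gastar a) (gadelta R[i] last_swap)) a).

(* For [a] in C[S_{n+1}] the trace is real, so that [Re] loses nothing; this is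
   asserted in the theorem. *)
Definition swap_vector (a : galg R[i] n.+2) : intpartn n.+2 -> R^o :=
  fun nu => complex.Re (swap_trace a nu).

Definition witness_vector (beta : intpartn n.+1) (gamma : intpartn n) :
    intpartn n.+2 -> R^o :=
  fun nu =>
    if adds_box (val beta) (val nu) then
      1 / (skew_content (val nu) (val beta)
           - skew_content (val beta) (val gamma))%:~R
    else 0.

End Generators.

(* Main.v *)
(** A trace on the Specht module S^nu is [x |-> k tau(P_nu x)], where tau is the
    coefficient of the identity, e_nu is the Young symmetrizer, [e_nu^2 = k e_nu]
    and P_nu is the central projection obtained by averaging the conjugates of
    e_nu.  With X_m the Jucys-Murphy elements, [s X_n = X_(n-1) s + 1]; since X_n
    acts on P_nu P_beta by the content c(nu/beta), compressing this identity to
    E = P_beta P_gamma shows that s acts on P_nu E by 1/(c(nu/beta) - c(beta/gamma)).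
    By the branching rule, the trace of [a^* s a] is therefore the sum over gamma
    < beta < nu of [k_beta tau((E a)(E a)^* )] divided by these differences: a
    combination of witnesses with nonnegative weights that do not depend on nu.
    The choice [a = E] isolates a single witness.

    The branching rule is proved together with [sum_nu P_nu = 1] by induction: S^beta
    occurs in S^nu when beta < nu, so that dim S^nu is at least the sum of the dim
    S^beta, while the squares of the dimensions have sum at most n!; the commutation
    relation of the up and down operators of Young's lattice turns both estimates
    into equalities. *)

From HB Require Import structures.
Require Import Defs.
From mathcomp Require Import all_boot all_order all_algebra all_fingroup.
From mathcomp Require Import mxrepresentation ring zify.

Set Implicit Arguments.
Unset Strict Implicit.
Unset Printing Implicit Defensive.

Import GroupScope Order.TTheory GRing.Theory Num.Theory.
Local Open Scope ring_scope.

(** * The star-algebra C[G] *)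

(** All levels live in one algebra C[S_N]: S_m is the subgroup [lowSym N m] fixing the points from m
    on, so that projections of different levels can be multiplied without embeddings. Modules,
    characters and Schur's lemma are replaced by the star and the faithful positive trace [gtau];
    modules enter only when the trace on a Specht module is computed. The obstacle is that a Young
    symmetrizer e is not self-adjoint. Its two factors b and a are, so positivity arguments use aba,
    a positive multiple of the product of the star of e with e. The lower bound on multiplicities is
    a statement about traces: a nonzero projection below P_nu has trace at least 1/k_nu. It applies
    when P_nu P_beta is nonzero, and this holds because restricting the coefficients of the
    symmetrizer of an extended tableau to the smaller group gives back the smaller symmetrizer.
    Contents come from the class sum of transpositions: the coefficient of a transposition in e is
    1, -1 or 0 according to whether it joins two entries of a row, of a column, or neither. A
    Jucys-Murphy element is half the difference of two successive such class sums over ordered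
    pairs. *)

Section GroupRing.
Variables (C : numClosedFieldType) (gT : finGroupType).

(** Over ['S_n] this type is convertible with [galg], and the products and stars agree as well, so
    elements pass freely between the two. *)
Definition gring : Type := {ffun gT -> C^o}.
HB.instance Definition _ := GRing.Lmodule.copy gring {ffun gT -> C^o}.

Implicit Types (x y z : gring) (g h : gT) (H K : {group gT}).

Definition gdelta g : gring := [ffun h => (h == g)%:R].
Definition gmul x y : gring := [ffun g => \sum_h x h * y (h^-1 * g)%g].

Lemma gringP x y : (forall g, x g = y g) <-> x = y.
Proof. by split=> [e|->//]; apply/ffunP. Qed.

Lemma gringDE x y g : (x + y) g = x g + y g. Proof. by rewrite ffunE. Qed.
Lemma gringNE x g : (- x) g = - x g. Proof. by rewrite ffunE. Qed.
Lemma gringZE (c : C) x g : (c *: x) g = c * x g. Proof. by rewrite ffunE. Qed.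
Lemma gring0E g : (0 : gring) g = 0. Proof. by rewrite ffunE. Qed.
Lemma gring_sumE I (r : seq I) (P : pred I) (F : I -> gring) g :
  (\sum_(i <- r | P i) F i) g = \sum_(i <- r | P i) F i g.
Proof. by apply: (big_morph (fun x : gring => x g)) => [x y|]; rewrite ffunE. Qed.

Fact gmulA : associative gmul.
Proof.
move=> x y z; apply/ffunP=> g; rewrite !ffunE.
under eq_bigr => h _ do rewrite ffunE mulr_sumr.
under [RHS]eq_bigr => h _ do rewrite ffunE mulr_suml.
rewrite [RHS]exchange_big /=; apply: eq_bigr => h _.
rewrite [RHS](reindex_inj (mulgI h)) /=; apply: eq_bigr => k _.
by rewrite mulKg mulrA invMg !mulgA.
Qed.
Fact gmul1r : left_id (gdelta 1) gmul.
Proof.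
move=> x; apply/ffunP=> g; rewrite !ffunE (bigD1 1%g) //= !ffunE eqxx mul1r.
rewrite invg1 mul1g big1 ?addr0 // => h /negPf hN1.
by rewrite ffunE hN1 mul0r.
Qed.
Fact gmulr1 : right_id (gdelta 1) gmul.
Proof.
move=> x; apply/ffunP=> g; rewrite !ffunE (bigD1 g) //= !ffunE mulVg eqxx.
rewrite mulr1 big1 ?addr0 // => h hNg.
rewrite ffunE -(inj_eq (mulgI h)) mulKVg mulg1 eq_sym (negPf hNg).
by rewrite mulr0.
Qed.
Fact gmulDl : left_distributive gmul +%R.
Proof.
move=> x y z; apply/ffunP=> g; rewrite !ffunE -big_split /=.
by apply: eq_bigr => h _; rewrite ffunE mulrDl.
Qed.
Fact gmulDr : right_distributive gmul +%R.
Proof.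
move=> x y z; apply/ffunP=> g; rewrite !ffunE -big_split /=.
by apply: eq_bigr => h _; rewrite ffunE mulrDr.
Qed.
Fact gdelta1_neq0 : gdelta 1 != 0.
Proof. by apply/eqP => /ffunP/(_ 1%g); rewrite !ffunE eqxx; apply/eqP/oner_neq0. Qed.

HB.instance Definition _ := GRing.Zmodule_isNzRing.Build gring
  gmulA gmul1r gmulr1 gmulDl gmulDr gdelta1_neq0.

Fact gscaleAl (c : C) x y : c *: (x * y) = (c *: x) * y.
Proof.
apply/ffunP=> g; rewrite !ffunE -[LHS]/(c * _) mulr_sumr.
by apply: eq_bigr => h _; rewrite ffunE mulrA.
Qed.
HB.instance Definition _ := GRing.Lmodule_isLalgebra.Build C gring gscaleAl.
Fact gscaleAr (c : C) x y : c *: (x * y) = x * (c *: y).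
Proof.
apply/ffunP=> g; rewrite !ffunE -[LHS]/(c * _) mulr_sumr.
by apply: eq_bigr => h _; rewrite ffunE mulrCA.
Qed.
HB.instance Definition _ := GRing.Lalgebra_isAlgebra.Build C gring gscaleAr.

Lemma gmulE x y g : (x * y) g = \sum_h x h * y (h^-1 * g)%g.
Proof. by rewrite ffunE. Qed.
Lemma gone : 1 = gdelta 1 :> gring. Proof. by []. Qed.

Lemma gdeltaE g h : gdelta g h = (h == g)%:R. Proof. by rewrite ffunE. Qed.

Lemma gdelta_mulE g x h : (gdelta g * x) h = x (g^-1 * h)%g.
Proof.
rewrite gmulE (bigD1 g) //= gdeltaE eqxx mul1r big1 ?addr0 // => k /negPf kNg.
by rewrite gdeltaE kNg mul0r.
Qed.

Lemma gmul_deltaE g x h : (x * gdelta g) h = x (h * g^-1)%g.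
Proof.
rewrite gmulE (bigD1 (h * g^-1)%g) //= gdeltaE invMg invgK mulgKV eqxx mulr1.
rewrite big1 ?addr0 // => k kN; rewrite gdeltaE; case: eqP => [e|_].
  by rewrite -e invMg invgK mulKVg eqxx in kN.
by rewrite mulr0.
Qed.

Lemma gdeltaM g h : gdelta (g * h) = gdelta g * gdelta h.
Proof.
apply/gringP=> k; rewrite gdelta_mulE !gdeltaE -(inj_eq (mulgI g^-1%g)).
by rewrite mulKg.
Qed.

Lemma gdeltaV g : gdelta g * gdelta g^-1 = 1.
Proof. by rewrite -gdeltaM mulgV. Qed.
Lemma gdeltaVl g : gdelta g^-1 * gdelta g = 1.
Proof. by rewrite -gdeltaM mulVg. Qed.

Lemma gringE x : x = \sum_g x g *: gdelta g.
Proof.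
apply/gringP=> h; rewrite gring_sumE (bigD1 h) //= gringZE gdeltaE eqxx mulr1.
by rewrite big1 ?addr0 // => k kNh; rewrite gringZE gdeltaE eq_sym (negPf kNh) mulr0.
Qed.

Definition gstar x : gring := [ffun g => (x g^-1%g)^*].

Lemma gstarE x g : gstar x g = (x g^-1%g)^*. Proof. by rewrite ffunE. Qed.
Fact gstar_is_zmod : zmod_morphism gstar.
Proof. by move=> x y; apply/gringP=> g; rewrite !(gstarE, gringDE, gringNE) rmorphB. Qed.
HB.instance Definition _ := GRing.isZmodMorphism.Build gring gring gstar gstar_is_zmod.
Lemma gstarZ c x : gstar (c *: x) = c^* *: gstar x.
Proof. by apply/gringP=> g; rewrite !(gstarE, gringZE) rmorphM. Qed.
Lemma gstarK : involutive gstar.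
Proof. by move=> x; apply/gringP=> g; rewrite !gstarE invgK conjCK. Qed.
Lemma gstar_delta g : gstar (gdelta g) = gdelta g^-1.
Proof.
apply/gringP=> h; rewrite gstarE !gdeltaE -(inj_eq invg_inj) invgK.
by rewrite conjC_nat.
Qed.
Lemma gstarM x y : gstar (x * y) = gstar y * gstar x.
Proof.
apply/gringP=> g; rewrite gstarE !gmulE rmorph_sum /=.
rewrite (reindex_inj (mulgI g^-1%g)) /= (reindex_inj invg_inj) /=.
rewrite [LHS](reindex_inj invg_inj) /=; apply: eq_bigr => h _.
by rewrite !gstarE rmorphM mulrC !invMg !invgK mulgK.
Qed.

Definition gtau x : C := x 1%g.
Fact gtau_is_scalar : scalar gtau.
Proof. by move=> c x y; rewrite /gtau gringDE gringZE. Qed.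
HB.instance Definition _ := GRing.isLinear.Build C gring C *%R gtau gtau_is_scalar.

Lemma gtau_delta g : gtau (gdelta g) = (g == 1%g)%:R.
Proof. by rewrite /gtau gdeltaE eq_sym. Qed.
Lemma gtau1 : gtau 1 = 1. Proof. by rewrite gtau_delta eqxx. Qed.
Lemma gtauM x y : gtau (x * y) = \sum_h x h * y h^-1%g.
Proof. by rewrite /gtau gmulE; apply: eq_bigr => h _; rewrite mulg1. Qed.
Lemma gtauC x y : gtau (x * y) = gtau (y * x).
Proof.
rewrite !gtauM (reindex_inj invg_inj); apply: eq_bigr => h _.
by rewrite invgK mulrC.
Qed.
Lemma gtau_mul_delta x g : gtau (x * gdelta g) = x g^-1%g.
Proof. by rewrite /gtau gmul_deltaE mul1g. Qed.
Lemma gtau_starE x : gtau (x * gstar x) = \sum_g `|x g| ^+ 2.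
Proof. by rewrite gtauM; apply: eq_bigr => g _; rewrite gstarE invgK normCK. Qed.
Lemma gtau_star_ge0 x : 0 <= gtau (x * gstar x).
Proof. by rewrite gtau_starE sumr_ge0 // => g _; rewrite exprn_ge0. Qed.
(** Faithfulness of the trace takes the place of semisimplicity: in particular a self-adjoint
    idempotent of trace zero vanishes. *)
Lemma gtau_star_gt0 x : x != 0 -> 0 < gtau (x * gstar x).
Proof.
move=> xN0; rewrite lt_neqAle gtau_star_ge0 andbT eq_sym; apply: contra_neq xN0.
rewrite gtau_starE => e; apply/gringP=> g; rewrite gring0E.
have/eqP := e; rewrite psumr_eq0 => [/allP/(_ g)|h _]; last by rewrite exprn_ge0.
by rewrite mem_index_enum => /(_ isT); rewrite expf_eq0 /= normr_eq0 => /eqP.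
Qed.

(** ** Support and restriction to a subgroup *)

Definition gsupp (H : {set gT}) x := [forall g, (g \notin H) ==> (x g == 0)].

Lemma gsuppP (H : {set gT}) x : reflect (forall g, g \notin H -> x g = 0) (gsupp H x).
Proof.
apply: (iffP forallP) => [h g gNH|h g]; last by apply/implyP=> /h->.
by have := h g; rewrite gNH => /eqP.
Qed.

Lemma gsuppE (H : {set gT}) x : gsupp H x -> x = \sum_(g in H) x g *: gdelta g.
Proof.
move=> /gsuppP sx; rewrite {1}[x]gringE [RHS]big_mkcond; apply: eq_bigr => g _.
by case: ifPn => // /sx->; rewrite scale0r.
Qed.

Lemma gsuppT x : gsupp [set: gT] x.
Proof. by apply/gsuppP=> g; rewrite inE. Qed.
Lemma gsuppS (H K : {set gT}) x : H \subset K -> gsupp H x -> gsupp K x.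
Proof.
by move=> /subsetP sHK /gsuppP sx; apply/gsuppP=> g gNK; rewrite sx //;
  apply: contra gNK => /sHK.
Qed.
Lemma gsupp_delta (H : {set gT}) g : g \in H -> gsupp H (gdelta g).
Proof.
move=> Hg; apply/gsuppP=> h hNH; rewrite gdeltaE; case: eqP => // e.
by rewrite e Hg in hNH.
Qed.
Lemma gsuppZ (H : {set gT}) c x : gsupp H x -> gsupp H (c *: x).
Proof. by move=> /gsuppP sx; apply/gsuppP=> g /sx; rewrite gringZE => ->; rewrite mulr0. Qed.
Lemma gsupp_sum (H : {set gT}) I (r : seq I) (P : pred I) (F : I -> gring) :
  (forall i, P i -> gsupp H (F i)) -> gsupp H (\sum_(i <- r | P i) F i).
Proof.
move=> sF; apply/gsuppP=> g gNH; rewrite gring_sumE big1 // => i /sF/gsuppP.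
by apply.
Qed.
Lemma gsupp1 H : gsupp H 1. Proof. exact/gsupp_delta/group1. Qed.
Lemma gsuppM H x y : gsupp H x -> gsupp H y -> gsupp H (x * y).
Proof.
move=> /gsuppE-> /gsuppE->; rewrite mulr_suml; apply: gsupp_sum => g Hg.
rewrite mulr_sumr; apply: gsupp_sum => h Hh.
by rewrite -scalerAl -scalerAr -gdeltaM !gsuppZ // gsupp_delta ?groupM.
Qed.
Lemma gsupp_star H x : gsupp H x -> gsupp H (gstar x).
Proof.
move=> /gsuppP sx; apply/gsuppP=> g gNH; rewrite gstarE sx ?rmorph0 //.
by rewrite groupV.
Qed.

Lemma comm_gsupp (H : {set gT}) x :
  (forall g, g \in H -> GRing.comm x (gdelta g)) ->
  forall y, gsupp H y -> GRing.comm x y.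
Proof.
move=> cx y /gsuppE->; rewrite /GRing.comm mulr_sumr mulr_suml.
by apply: eq_bigr => g Hg; rewrite -scalerAr -scalerAl cx.
Qed.

(** For a subgroup H this is the conditional expectation onto C[H]: a C[H]-bimodule map preserving
    [gtau]. Traces descend from one level to the next through it. *)
Definition gres (H : {set gT}) x : gring := [ffun g => if g \in H then x g else 0].
Lemma gresE (H : {set gT}) x g : gres H x g = if g \in H then x g else 0.
Proof. by rewrite ffunE. Qed.
Fact gres_is_linear (H : {set gT}) : linear (gres H).
Proof.
move=> c x y; apply/gringP=> g; rewrite gringDE gringZE !gresE.
by case: ifP => _; rewrite ?gringDE ?gringZE // mulr0 addr0.
Qed.
HB.instance Definition _ H := GRing.isLinear.Build C gring gring *:%R (gres H) (gres_is_linear H).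
Lemma gsupp_res (H : {set gT}) x : gsupp H (gres H x).
Proof. by apply/gsuppP=> g /negPf; rewrite gresE => ->. Qed.
Lemma gtau_res H x : gtau (gres H x) = gtau x.
Proof. by rewrite /gtau gresE group1. Qed.
Lemma gresMl H x y : gsupp H y -> gres H (y * x) = y * gres H x.
Proof.
move=> /gsuppE->; rewrite !mulr_suml linear_sum; apply: eq_bigr => g Hg.
rewrite -!scalerAl linearZ /=; congr (_ *: _); apply/gringP=> h.
by rewrite gresE !gdelta_mulE gresE groupMl ?groupV.
Qed.
Lemma gresMr H x y : gsupp H y -> gres H (x * y) = gres H x * y.
Proof.
move=> /gsuppE->; rewrite !mulr_sumr linear_sum; apply: eq_bigr => g Hg.
rewrite -!scalerAr linearZ /=; congr (_ *: _); apply/gringP=> h.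
by rewrite gresE !gmul_deltaE gresE groupMr ?groupV.
Qed.

(** ** Averaging over conjugation *)

Definition gavg (H : {set gT}) x : gring :=
  \sum_(g in H) gdelta g * x * gdelta g^-1.

Lemma gavgZ (H : {set gT}) c x : gavg H (c *: x) = c *: gavg H x.
Proof.
rewrite /gavg scaler_sumr; apply: eq_bigr => g _.
by rewrite -scalerAr -scalerAl.
Qed.
Lemma gsupp_avg H x : gsupp H x -> gsupp H (gavg H x).
Proof.
by move=> sx; apply: gsupp_sum => g Hg; rewrite !gsuppM ?gsupp_delta ?groupV.
Qed.
Lemma gavg_comm H x y : gsupp H y -> GRing.comm (gavg H x) y.
Proof.
apply: comm_gsupp => h Hh; rewrite /GRing.comm /gavg mulr_suml mulr_sumr.
rewrite (reindex_inj (mulgI h)) /=; apply: eq_big => [g|g _].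
  by rewrite groupMl.
by rewrite invMg !gdeltaM -!mulrA gdeltaVl mulr1.
Qed.
(** Since ba and ab have the same average, the average of a symmetrizer is self-adjoint although the
    symmetrizer is not. *)
Lemma gavgC H x y : gsupp H x -> gavg H (x * y) = gavg H (y * x).
Proof.
move=> /gsuppE->; rewrite mulr_suml mulr_sumr /gavg.
under eq_bigr => g _ do rewrite mulr_sumr mulr_suml.
under [RHS]eq_bigr => g _ do rewrite mulr_sumr mulr_suml.
rewrite exchange_big [RHS]exchange_big; apply: eq_bigr => h Hh.
rewrite [RHS](reindex_inj (mulIg h)) /=; apply: eq_big => [g|g _].
  by rewrite groupMr.
rewrite -?(scalerAl, scalerAr) invMg !gdeltaM -!mulrA.
by rewrite [gdelta h * (gdelta h^-1 * _)]mulrA gdeltaV mul1r.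
Qed.
Lemma gstar_avg (H : {set gT}) x : gstar (gavg H x) = gavg H (gstar x).
Proof.
rewrite raddf_sum /=; apply: eq_bigr => g _.
by rewrite !gstarM !gstar_delta invgK mulrA.
Qed.
Lemma gtau_avg (H : {set gT}) x : gtau (gavg H x) = #|H|%:R * gtau x.
Proof.
rewrite raddf_sum /= mulr_natl -sumr_const; apply: eq_bigr => g _.
by rewrite gtauC mulrA gdeltaVl mul1r.
Qed.
Lemma gavg_mulC H x y :
  (forall g, g \in H -> GRing.comm y (gdelta g)) -> gavg H x * y = gavg H (x * y).
Proof.
move=> cy; rewrite mulr_suml; apply: eq_bigr => g Hg.
by rewrite -!mulrA [y * _]cy ?groupV.
Qed.

End GroupRing.
Arguments gdelta {C gT} g.

(** * Primitive idempotents of C[H] *)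

Section PrimitivePair.
Variables (C : numClosedFieldType) (gT : finGroupType).
Local Notation A := (gring C gT).
Implicit Types (x y a b e p q : A) (g h : gT) (H K : {group gT}).

Definition gkappa e : C := gtau (e * e).
(** The square comes from the unnormalised average, which acts on e by k squared: one factor k for
    each of two sandwiches between copies of e. *)
Definition gproj H e : A := (gkappa e ^+ 2)^-1 *: gavg H e.

(** The model is b the column antisymmetrizer and a the row symmetrizer. The factors are kept apart
    because they are self-adjoint and their product is not. The last field makes the product
    primitive, and [pp_tau] fixes its scale. *)
Record primitive_pair H b a : Prop := PrimitivePair {
  pp_suppb : gsupp H b;
  pp_suppa : gsupp H a;
  pp_starb : gstar b = b;
  pp_stara : gstar a = a;
  pp_sqb : exists2 r : C, 0 < r & b * b = r *: b;
  pp_sqa : exists2 r : C, 0 < r & a * a = r *: a;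
  pp_tau : gtau (b * a) = 1;
  pp_prim : forall x, gsupp H x -> exists c : C, b * a * x * (b * a) = c *: (b * a)
}.

Lemma gtau_proj_ge0 q : gstar q = q -> q * q = q -> 0 <= gtau q.
Proof. by move=> sq qq; rewrite -qq -{2}sq gtau_star_ge0. Qed.

Lemma gproj_comm H e x : gsupp H x -> GRing.comm (gproj H e) x.
Proof.
move=> sx; have := gavg_comm e sx.
by rewrite /GRing.comm -scalerAl -scalerAr => ->.
Qed.

Section Theory.
Variables (H : {group gT}) (b a : A).
Hypothesis pp : primitive_pair H b a.
Let e := b * a.
Let k := gkappa e.
Let P := gproj H e.

Lemma pp_supp : gsupp H e.
Proof. by rewrite gsuppM ?(pp_suppb pp) ?(pp_suppa pp). Qed.

Lemma pp_neq0 : e != 0.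
Proof.
by apply/eqP => e0; have := pp_tau pp; rewrite -/e e0 linear0 => /eqP; rewrite eq_sym oner_eq0.
Qed.

(** Primitivity gives some scalar; taking [gtau], with e of trace 1, identifies it. *)
Lemma pp_sandwich x : gsupp H x -> e * x * e = (k * gtau (x * e)) *: e.
Proof.
move=> sx.
have [c ec] := pp_prim pp sx; rewrite -/e in ec.
have [c1] := pp_prim pp (gsupp1 C H); rewrite mulr1 -/e => e1.
have c1k : c1 = k by rewrite /k /gkappa e1 linearZ /= (pp_tau pp) mulr1.
have -> : k * gtau (x * e) = c; last by [].
have := congr1 (@gtau C gT) ec; rewrite linearZ /= (pp_tau pp) mulr1 => <-.
by rewrite -mulrA [in RHS]gtauC -mulrA e1 -scalerAr linearZ /= c1k.
Qed.

Lemma pp_sq : e * e = k *: e.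
Proof.
have := pp_sandwich (gsupp1 C H); rewrite mulr1 mul1r => ->.
by rewrite (pp_tau pp) mulr1.
Qed.

(** The element h = aba is a positive multiple of the star of e times e, so it has positive trace;
    also h squared is [ra * k] times h. Comparing traces of h and of its square gives the sign of
    k. *)
Lemma pp_kappa_gt0 : 0 < k.
Proof.
have [ra ra0 aa] := pp_sqa pp; have [rb rb0 bb] := pp_sqb pp.
pose h := a * b * a.
have hE : h = rb^-1 *: (gstar e * gstar (gstar e)).
  rewrite gstarK gstarM (pp_stara pp) (pp_starb pp) /e mulrA -[a * b * b]mulrA bb.
  by rewrite -scalerAr -scalerAl scalerA mulVf ?gt_eqF // scale1r.
have eN0 : gstar e != 0 by rewrite -(inj_eq (can_inj (@gstarK C gT))) gstarK raddf0 pp_neq0.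
have th : 0 < gtau h.
  by rewrite hE linearZ /= mulr_gt0 ?invr_gt0 ?gtau_star_gt0.
have sh : gstar h = h by rewrite !gstarM (pp_stara pp) (pp_starb pp) mulrA.
have hh : h * h = (ra * k) *: h.
  rewrite /h -scalerA -!mulrA [a * (a * _)]mulrA aa -scalerAl -!scalerAr.
  by rewrite -[b * (a * (b * a))]/(b * (a * e)) [b * _]mulrA -/e pp_sq -!scalerAr.
have hN0 : h != 0 by apply: contraTneq th => ->; rewrite linear0 ltxx.
have := gtau_star_gt0 hN0; rewrite sh hh linearZ /= pmulr_lgt0 //.
by rewrite pmulr_rgt0.
Qed.
Let k_neq0 : k != 0. Proof. by rewrite gt_eqF ?pp_kappa_gt0. Qed.

Lemma gavg_pp_mul : gavg H e * e = k ^+ 2 *: e.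
Proof.
have ce : GRing.comm (gavg H e) e by apply: gavg_comm; apply: pp_supp.
have sand g : g \in H ->
    e * (gdelta g * e * gdelta g^-1) * e = (k ^+ 2 * (e g * e g^-1%g)) *: e.
  move=> Hg; have -> : e * (gdelta g * e * gdelta g^-1) * e =
    (e * gdelta g * e) * gdelta g^-1 * e by rewrite !mulrA.
  rewrite pp_sandwich ?gsupp_delta // -!scalerAl pp_sandwich ?gsupp_delta ?groupV //.
  rewrite ![gtau (gdelta _ * _)]gtauC !gtau_mul_delta invgK scalerA; congr (_ *: _).
  by rewrite mulrACA -expr2 [_ * e g]mulrC.
(* The average commutes with e, so k times the left side is e z e with z the average. Each summand
   is sandwiched twice, and the remaining sum of [e g * e g^-1] is again k. *)
apply: (scalerI k_neq0); rewrite scalerAr -pp_sq mulrA ce.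
rewrite mulr_sumr mulr_suml (eq_bigr _ sand) -scaler_suml scalerA; congr (_ *: _).
rewrite -mulr_sumr mulrC; congr (_ * _).
rewrite -[RHS]/(gtau (e * e)) gtauM [RHS](bigID (mem H)) /= [X in _ + X]big1 ?addr0 //.
by move=> g gNH; move/gsuppP: pp_supp => -> //; rewrite mul0r.
Qed.

Lemma gprojE : gavg H e = k ^+ 2 *: P.
Proof. by rewrite scalerA mulfV ?scale1r // expf_neq0. Qed.

Lemma gsupp_proj : gsupp H P.
Proof. by rewrite gsuppZ ?gsupp_avg ?pp_supp. Qed.

Lemma gproj_id : P * e = e.
Proof. by rewrite -scalerAl gavg_pp_mul scalerA mulVf ?scale1r // expf_neq0. Qed.

Lemma gproj_conj g x : g \in H -> P * x = x ->
  P * (gdelta g * x * gdelta g^-1) = gdelta g * x * gdelta g^-1.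
Proof.
by move=> Hg Px; rewrite !mulrA gproj_comm ?gsupp_delta // -[_ * P * _]mulrA Px.
Qed.

Lemma gproj_idem : P * P = P.
Proof.
rewrite {2 3}/P -scalerAr; congr (_ *: _); rewrite mulr_sumr.
by apply: eq_bigr => g Hg; rewrite gproj_conj ?gproj_id.
Qed.

Lemma gstar_proj : gstar P = P.
Proof.
rewrite gstarZ gstar_avg gstarM (pp_starb pp) (pp_stara pp).
rewrite -gavgC ?(pp_suppb pp) //; congr (_ *: _).
by rewrite conj_Creal // rpredV rpredX // gtr0_real ?pp_kappa_gt0.
Qed.

Lemma gtau_proj : gtau P = #|H|%:R / k ^+ 2.
Proof. by rewrite linearZ /= gtau_avg (pp_tau pp) mulr1 mulrC. Qed.

Lemma gtau_proj_gt0 : 0 < gtau P.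
Proof.
by rewrite gtau_proj divr_gt0 ?exprn_gt0 ?pp_kappa_gt0 // ltr0n cardG_gt0.
Qed.

(** A central x satisfies x e e = e x e, so the sandwich identity makes it a scalar on e; averaging
    carries this scalar over to P. It yields both the restriction multiplicities and the eigenvalues
    of class sums. *)
Lemma gproj_central x : gsupp H x ->
  (forall g, g \in H -> GRing.comm x (gdelta g)) -> x * P = gtau (x * e) *: P.
Proof.
move=> sx cx.
have xe : x * e = gtau (x * e) *: e.
  apply: (scalerI k_neq0); rewrite scalerA -pp_sandwich // scalerAr -pp_sq mulrA.
  by rewrite (comm_gsupp cx pp_supp).
move: (gtau (x * e)) xe => c xe.
have cxz : GRing.comm x (gavg H e) by apply: comm_gsupp cx _ _; rewrite gsupp_avg ?pp_supp.
rewrite -scalerAr cxz gavg_mulC // -(comm_gsupp cx pp_supp) xe gavgZ scalerA.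
by rewrite mulrC -scalerA.
Qed.

(** The normalised aba is a self-adjoint substitute for e: a minimal projection under P, of trace
    1/k, whose conjugates average to a multiple of P. *)
Lemma minproj_exists : exists p, [/\ gsupp H p, gstar p = p, p * p = p,
  forall x, gsupp H x -> exists c : C, p * x * p = c *: p &
  [/\ P * p = p, gtau p = k^-1 & gavg H p = k *: P]].
Proof.
have [r r0 aa] := pp_sqa pp; have sa := pp_suppa pp; have sb := pp_suppb pp.
have rk0 : r * k != 0 by rewrite mulf_neq0 // gt_eqF.
have ae : gtau (a * e) = r.
  by rewrite gtauC /e -mulrA aa -scalerAr linearZ /= (pp_tau pp) mulr1.
have hx x : a * b * a * x * (a * b * a) = a * (e * (x * a) * e).
  by rewrite /e !mulrA.
exists ((r * k)^-1 *: (a * b * a)); split.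
- by rewrite gsuppZ ?gsuppM.
- rewrite gstarZ !gstarM (pp_stara pp) (pp_starb pp) mulrA conj_Creal //.
  by rewrite rpredV rpredM // gtr0_real ?pp_kappa_gt0.
- rewrite -scalerAl -scalerAr scalerA -[X in X * (a * b * a)]mulr1 hx mul1r.
  rewrite pp_sandwich // ae -scalerAr [a * e]mulrA scalerA [k * r]mulrC.
  by rewrite divfK.
- move=> x sx; have [c ec] := pp_prim pp (gsuppM sx sa).
  exists ((r * k)^-1 * c); rewrite -!scalerAl -scalerAr hx ec -scalerAr !scalerA.
  by rewrite mulrA mulrAC -mulrA mulrC !mulrA.
split.
- rewrite -scalerAr; congr (_ *: _).
  have -> : P * (a * b * a) = (P * a) * e by rewrite !mulrA.
  by rewrite gproj_comm // -mulrA gproj_id mulrA.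
- rewrite linearZ /= gtauC mulrA aa -scalerAl linearZ /= gtauC (pp_tau pp) mulr1.
  by rewrite invfM mulrAC mulVf ?gt_eqF // mul1r.
- rewrite gavgZ -mulrA gavgC // -mulrA aa -scalerAr gavgZ scalerA gprojE scalerA.
  by congr (_ *: _); field; rewrite k_neq0 gt_eqF.
Qed.

(** The minimal projection p is equivalent to a subprojection of q: some y = p g q is nonzero, since
    the conjugates of p add up to k P. Then y y* is a multiple t of p, so y* y / t is a projection
    under q with the trace of p. *)
Lemma gtau_subproj_ge q : gsupp H q -> gstar q = q -> q * q = q -> P * q = q ->
  q != 0 -> k^-1 <= gtau q.
Proof.
move=> sq sq' qq Pq qN0.
have [p [sp sp' pp_ pxp [Pp tp avp]]] := minproj_exists.
have [/existsP[g /andP[Hg yN0]]|none] :=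
    boolP [exists g, (g \in H) && (p * gdelta g * q != 0)]; last first.
  have : k *: q = 0.
    rewrite -{1}Pq scalerAl -avp mulr_suml big1 // => g Hg.
    apply/eqP; move: none; rewrite negb_exists => /forallP/(_ g^-1%g).
    rewrite groupV Hg negbK => /eqP pgq.
    by rewrite -!mulrA [p * _]mulrA pgq mulr0.
  by move/eqP; rewrite scaler_eq0 (negPf k_neq0) (negPf qN0).
set y := p * gdelta g * q in yN0.
have sy : gstar y = q * gdelta g^-1 * p.
  by rewrite !gstarM gstar_delta sq' sp' mulrA.
have [t yy] : exists t : C, y * gstar y = t *: p.
  have [|t et] := pxp (gdelta g * q * gdelta g^-1).
    by rewrite !gsuppM ?gsupp_delta ?groupV.
  by exists t; rewrite -et sy /y !mulrA -[_ * q * q]mulrA qq.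
have t0 : 0 < t.
  have := gtau_star_gt0 yN0; rewrite yy linearZ /= tp pmulr_lgt0 //.
  by rewrite invr_gt0 pp_kappa_gt0.
have tN0 : t != 0 by rewrite gt_eqF.
have py : p * y = y by rewrite /y !mulrA pp_.
pose u := t^-1 *: (gstar y * y).
have su : gstar u = u.
  by rewrite gstarZ gstarM gstarK conj_Creal // rpredV gtr0_real.
have uu : u * u = u.
  rewrite /u -scalerAl -scalerAr -mulrA [y * _]mulrA yy -scalerAl py -scalerAr.
  by rewrite scalerA mulVf // scale1r.
have qu : q * u = u by rewrite /u -scalerAr sy !mulrA qq.
have uq : u * q = u by rewrite /u -scalerAl /y -!mulrA qq.
have tu : gtau u = k^-1 by rewrite linearZ /= gtauC yy linearZ /= mulKf.
rewrite -subr_ge0 -tu -linearB; apply: gtau_proj_ge0; first by rewrite raddfB /= sq' su.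
by rewrite mulrBl !mulrBr qq uu qu uq subrr subr0.
Qed.

End Theory.
Lemma gproj_orth H e e' :
  (forall g, g \in H -> e * gdelta g * e' = 0) -> gproj H e * gproj H e' = 0.
Proof.
move=> ee'; rewrite -scalerAl -scalerAr mulr_suml big1 ?scaler0 // => g Hg.
rewrite mulr_sumr big1 // => h Hh.
have -> : gdelta g * e * gdelta g^-1 * (gdelta h * e' * gdelta h^-1) =
    gdelta g * (e * gdelta (g^-1 * h) * e') * gdelta h^-1.
  by rewrite gdeltaM !mulrA.
by rewrite ee' ?groupM ?groupV // mulr0 mul0r.
Qed.

(** * Central projections of a group and of a subgroup *)

Section TwoLevels.
Variables (H K : {group gT}) (b a b' a' : A).
Hypotheses (sKH : K \subset H).
Hypotheses (pp : primitive_pair H b a) (pp' : primitive_pair K b' a').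
Let e := b * a.
Let e' := b' * a'.
Let k := gkappa e.
Let k' := gkappa e'.
Let P := gproj H e.
Let P' := gproj K e'.
Let m := gtau (P * e').

Let comm_PP' : P * P' = P' * P.
Proof. exact: gproj_comm (gsuppS sKH (gsupp_proj pp')). Qed.

(** The restriction of P to K is central in C[K], hence acts on P' by a scalar. That scalar m is the
    multiplicity in the restricted module, up to the factor k'/k. *)
Lemma gres_gprojM : gres K P * P' = m *: P'.
Proof.
have -> : m = gtau (gres K P * e').
  by rewrite -gresMr ?gtau_res // (pp_supp pp').
apply: (gproj_central pp'); first exact: gsupp_res.
move=> g Kg; rewrite /GRing.comm -gresMr ?gsupp_delta // -gresMl ?gsupp_delta //.
by rewrite gproj_comm // gsupp_delta ?(fintype.subsetP sKH).
Qed.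

Lemma gtau_gprojM_res y : gsupp K y -> gtau (P * P' * y) = m * gtau (P' * y).
Proof.
move=> sy; have sPy : gsupp K (P' * y) by rewrite gsuppM ?(gsupp_proj pp').
rewrite -mulrA -(gtau_res K) gresMr // mulrA gres_gprojM -scalerAl.
by rewrite linearZ.
Qed.

Lemma gstar_gprojM : gstar (P * P') = P * P'.
Proof. by rewrite gstarM (gstar_proj pp) (gstar_proj pp'). Qed.

Lemma gproj_idemM : P * P' * (P * P') = P * P'.
Proof.
by rewrite {1}comm_PP' -mulrA [P * (P * _)]mulrA (gproj_idem pp) comm_PP' mulrA
  (gproj_idem pp').
Qed.

Lemma gtau_gprojM : gtau (P * P') = m * gtau P'.
Proof.
by have := gtau_gprojM_res (gsupp1 C K); rewrite !mulr1.
Qed.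

Lemma gmult_ge0 : 0 <= m.
Proof.
rewrite -(pmulr_lge0 _ (gtau_proj_gt0 pp')) -/P' -gtau_gprojM.
exact: gtau_proj_ge0 gstar_gprojM gproj_idemM.
Qed.

Lemma gmult_eq0 : m = 0 -> P * P' = 0.
Proof.
move=> m0; apply/eqP; apply: contraT => /gtau_star_gt0.
by rewrite gstar_gprojM gproj_idemM gtau_gprojM m0 mul0r ltxx.
Qed.

(** For p minimal under P', the product P p is a projection under P with trace m/k'. It is nonzero
    because P commutes with K and the conjugates of p add up to k' P', so its trace is at least
    1/k. *)
Lemma gmult_ge : P * P' != 0 -> k' / k <= m.
Proof.
move=> PP'N0; have [p [sp sp' pp_ _ [P'p tp avp]]] := minproj_exists pp'.
have sHp := gsuppS sKH sp.
have Pp : P * p = p * P by apply: gproj_comm.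
have k'0 : 0 < k' by apply: pp_kappa_gt0 pp'.
have tPp : gtau (P * p) = m / k'.
  by rewrite -P'p mulrA gtau_gprojM_res // P'p tp.
rewrite mulrC -ler_pdivlMr // -tPp; apply: (gtau_subproj_ge pp).
- by rewrite gsuppM ?(gsupp_proj pp).
- by rewrite gstarM sp' (gstar_proj pp).
- by rewrite {1}Pp -mulrA [P * (P * _)]mulrA (gproj_idem pp) Pp mulrA pp_.
- by rewrite mulrA (gproj_idem pp).
apply: contra PP'N0 => /eqP Pp0.
suff : k' *: (P * P') = 0 by move/eqP; rewrite scaler_eq0 (gt_eqF k'0).
rewrite scalerAr -avp mulr_sumr big1 // => g Kg.
have cg : GRing.comm P (gdelta g).
  by apply: gproj_comm; rewrite gsupp_delta ?(fintype.subsetP sKH).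
by rewrite !mulrA cg -[_ * P * p]mulrA Pp0 mulr0 mul0r.
Qed.

End TwoLevels.
End PrimitivePair.

(** * Young's lattice *)

Section Boxes.
Implicit Types (s t : seq nat) (b : nat * nat).

Lemma mem_boxes s b : (b \in boxes s) = (b.2 < nth 0 s b.1)%N.
Proof.
case: b => i j; apply/allpairsPdep/idP => /= [[i' [j' []]]|lt_j].
  by rewrite !mem_iota /= => _ lt_j [-> ->].
exists i, j; rewrite !mem_iota /=; split=> //=.
by rewrite ltnNge; apply: contraL lt_j => /(nth_default 0%N)->.
Qed.

Lemma boxes_uniq s : uniq (boxes s).
Proof.
by apply: allpairs_uniq_dep => [|i _|[i j] [i' j'] _ _ [-> ->]//]; rewrite iota_uniq.
Qed.

Lemma size_boxes s : size (boxes s) = sumn s.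
Proof.
rewrite size_allpairs_dep; congr sumn; apply: (@eq_from_nth _ 0%N) => [|i].
  by rewrite size_map size_iota.
rewrite size_map size_iota => lt_i.
by rewrite (nth_map 0%N) ?size_iota // nth_iota // size_iota.
Qed.

Lemma count_boxes_col s j : count (fun b => b.2 == j) (boxes s) = count (ltn j) s.
Proof.
rewrite -!sum1_count big_mkcond big_allpairs_dep /=.
rewrite [RHS]big_mkcond [RHS](big_nth 0%N) /index_iota subn0.
apply: eq_bigr => i _; rewrite -big_mkcond sum1_count.
rewrite -/(count_mem j _) count_uniq_mem ?iota_uniq // mem_iota /=.
by case: ltnP.
Qed.

End Boxes.

Section Partitions.
Variable m : nat.
Implicit Types nu : intpartn m.

Lemma partn_sum nu : sumn (val nu) = m.
Proof. by case/and3P: (valP nu) => _ _ /eqP. Qed.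

Lemma partn_leS nu i : (nth 0 (val nu) i.+1 <= nth 0 (val nu) i)%N.
Proof.
have [lt_i|le_i] := ltnP i.+1 (size (val nu)); last by rewrite nth_default.
by case/and3P: (valP nu) => /(sortedP 0%N)/(_ _ lt_i).
Qed.

Lemma partn_le nu i j : (i <= j)%N -> (nth 0 (val nu) j <= nth 0 (val nu) i)%N.
Proof.
move/subnK<-; elim: (_ - _)%N => // d IH.
by rewrite addSn (leq_trans (partn_leS nu _)).
Qed.

Lemma partn_gt0 nu i : (i < size (val nu))%N -> (0 < nth 0 (val nu) i)%N.
Proof.
move=> lt_i; case/and3P: (valP nu) => _ nu0 _; rewrite lt0n.
by apply: contra nu0 => /eqP <-; rewrite mem_nth.
Qed.

Lemma partn_size nu : (size (val nu) <= m)%N.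
Proof.
rewrite -[X in (_ <= X)%N](partn_sum nu); have := @partn_gt0 nu.
elim: (val nu) => //= x s IH gt0.
by rewrite -add1n leq_add ?(gt0 0%N) // IH // => i lt_i; apply: (gt0 i.+1).
Qed.

Lemma partn_nth0 nu i : (m <= i)%N -> nth 0%N (val nu) i = 0%N.
Proof. by move=> le_i; rewrite nth_default // (leq_trans (partn_size nu)). Qed.

Lemma partn_inj nu nu' : (forall i, nth 0%N (val nu) i = nth 0%N (val nu') i) -> nu = nu'.
Proof.
move=> e; apply: val_inj; apply: (@eq_from_nth _ 0%N) => [|i _ //].
apply/eqP; rewrite eqn_leq; apply/andP; split; rewrite leqNgt; apply/negP=> /partn_gt0.
  by rewrite e nth_default.
by rewrite -e nth_default.
Qed.

Lemma partn_bigsum nu K : (m <= K)%N -> (\sum_(i < K) nth 0 (val nu) i)%N = m.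
Proof.
move=> le_K; rewrite -[RHS](partn_sum nu) sumnE (big_nth 0%N) big_mkord.
have le_s := leq_trans (partn_size nu) le_K.
rewrite [RHS](big_ord_widen _ (nth 0%N (val nu)) le_s) [RHS]big_mkcond.
apply: eq_bigr => i _; case: ltnP => // /(nth_default 0%N).
by [].
Qed.

Lemma partn_of_fun K (f : nat -> nat) : (forall i, f i.+1 <= f i)%N -> f K = 0%N ->
  (\sum_(i < K) f i)%N = m -> exists nu, forall i, nth 0%N (val nu) i = f i.
Proof.
move=> fS fK sf.
have fle i j : (i <= j)%N -> (f j <= f i)%N.
  by move/subnK<-; elim: (j - i)%N => // d IH; rewrite addSn (leq_trans (fS _)).
(* The list is cut at the first empty row, because zeros are excluded from partitions. *)
pose k := ex_minn (ex_intro (fun i => f i == 0%N) K (introT eqP fK)).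
have [fk0 kmin] : f k = 0%N /\ forall i, (i < k)%N -> (0 < f i)%N.
  rewrite /k; case: ex_minnP => l /eqP fl lmin; split=> // i; rewrite ltnNge lt0n.
  by apply: contra => /lmin.
have le_kK : (k <= K)%N by rewrite leqNgt; apply/negP=> /kmin; rewrite fK.
have nthf i : nth 0%N (mkseq f k) i = f i.
  have [lt_i|le_i] := ltnP i k; first by rewrite nth_mkseq.
  by rewrite nth_default ?size_mkseq //; apply/esym/eqP; rewrite -leqn0 -fk0 fle.
have pf : is_partn m (mkseq f k).
  apply/and3P; split.
  - by apply/(sortedP 0%N) => i _; rewrite !nthf; apply: fS.
  - by apply/mapP=> -[i]; rewrite mem_iota => /kmin; lia.
  - rewrite sumnE big_map -{1}[k]subn0 big_mkord -sf; apply/eqP.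
    rewrite (big_ord_widen _ f le_kK) [LHS]big_mkcond /=; apply: eq_bigr => i _.
    case: ltnP => // /fle; rewrite fk0; lia.
by exists (exist (fun s => is_partn m s) _ pf) => i; rewrite /= nthf.
Qed.

(** Padding the rows with zeros up to length m embeds partitions in a finite type, which makes sums
    over all partitions available. *)
Definition partn_code nu : {ffun 'I_m -> 'I_m.+1} := [ffun i : 'I_m => inord (nth 0%N (val nu) i)].
Definition partn_decode (f : {ffun 'I_m -> 'I_m.+1}) : option (intpartn m) :=
  insub [seq x <- [seq val (f i) | i <- enum 'I_m] | x != 0%N].

Lemma partn_codeK : pcancel partn_code partn_decode.
Proof.
move=> nu; rewrite /partn_decode.
have -> : [seq val (partn_code nu i) | i <- enum 'I_m] = mkseq (nth 0%N (val nu)) m.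
  rewrite /mkseq -val_enum_ord -map_comp; apply: eq_map => i /=.
  rewrite ffunE inordK // ltnS -[X in (_ <= X)%N](partn_bigsum nu (leqnn m)).
  by rewrite (bigD1 i) //= leq_addr.
have -> : [seq x <- mkseq (nth 0%N (val nu)) m | x != 0%N] = val nu; last exact: valK.
rewrite /mkseq.
have -> : iota 0 m = iota 0 (size (val nu)) ++ iota (size (val nu)) (m - size (val nu)).
  by rewrite -[X in iota X (m - _)]add0n -iotaD subnKC ?partn_size.
rewrite map_cat filter_cat.
rewrite -/(mkseq _ _) mkseq_nth (all_filterP _).
  rewrite -[RHS]cats0; congr (_ ++ _); apply/eqP; rewrite -size_eq0 size_filter.
  rewrite -leqn0 leqNgt -has_count; apply/hasPn => x /mapP[i].
  by rewrite mem_iota => /andP[le_i _] ->; rewrite nth_default.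
apply/allP=> x xs; case/and3P: (valP nu) => _ nu0 _.
by apply: contra nu0 => /eqP<-.
Qed.
End Partitions.

HB.instance Definition _ m := Countable.copy (intpartn m) {s : seq nat | is_partn m s}.
HB.instance Definition _ m : isFinite (intpartn m) := PCanIsFinite (@partn_codeK m).

Section Shapes.
Implicit Types (K m : nat) (f : nat -> nat).

Lemma leq_sum_eq K (f g : nat -> nat) : (forall i, i < K -> f i <= g i)%N ->
  (\sum_(i < K) g i <= \sum_(i < K) f i)%N -> forall i, (i < K)%N -> f i = g i.
Proof.
elim: K => // K IH le_fg; rewrite !big_ord_recr /= => le_sum i.
have le1 : (\sum_(i < K) f i <= \sum_(i < K) g i)%N.
  by apply: leq_sum => j _; rewrite le_fg // ltnS ltnW.
have leK := le_fg K (ltnSn K).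
move: le_sum le1 IH; set F := (\sum_(i < K) f i)%N; set G := (\sum_(i < K) g i)%N.
move=> le_sum le1 IH.
rewrite ltnS leq_eqVlt => /orP[/eqP->|]; first lia.
by apply: IH => [j lt_j|]; [apply: le_fg; lia | lia].
Qed.

Definition has_shape K m f (nu : intpartn m) := [forall i : 'I_K, nth 0%N (val nu) i == f i].

Lemma has_shapeP K m f (nu : intpartn m) : (m <= K)%N -> (forall i, (K <= i)%N -> f i = 0%N) ->
  reflect (forall i, nth 0%N (val nu) i = f i) (has_shape K f nu).
Proof.
move=> le_mK f0; apply: (iffP forallP) => [e i|e i]; last by rewrite e.
have [lt_i|le_i] := ltnP i K; first by apply/eqP; apply: (e (Ordinal lt_i)).
by rewrite f0 // partn_nth0 // (leq_trans le_mK).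
Qed.

Lemma card_shape K m f : (m <= K)%N -> (forall i, (K <= i)%N -> f i = 0%N) ->
  (\sum_(i < K) f i)%N = m ->
  #|[set nu : intpartn m | has_shape K f nu]| = [forall i : 'I_K, f i.+1 <= f i]%N :> nat.
Proof.
move=> le_mK f0 sf; case: forallP => [fS|nfS].
  have [|||nu enu] := @partn_of_fun m K f; [|by apply: f0|by []|].
    move=> i; have [lt_i|le_i] := ltnP i K; first exact: (fS (Ordinal lt_i)).
    by rewrite f0 // leqW.
  rewrite (_ : [set _ | _] = [set nu]) ?cards1 //; apply/setP=> nu'; rewrite !inE.
  apply/has_shapeP/eqP => // [e|-> //]; apply: partn_inj => i.
  by rewrite e enu.
apply: eq_card0 => nu; rewrite !inE; apply/negP => /has_shapeP e; apply: nfS => i.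
by rewrite -!e // partn_leS.
Qed.

(** The sizes differ by one, so containment of diagrams already leaves exactly one box. *)
Lemma adds_boxP m (beta : intpartn m) (nu : intpartn m.+1) :
  reflect (forall i, nth 0 (val beta) i <= nth 0 (val nu) i)%N (adds_box (val beta) (val nu)).
Proof.
apply: (iffP andP) => [[/allP sub _] i|le_bn].
  rewrite leqNgt; apply/negP=> lt_i; have := sub (i, nth 0%N (val nu) i).
  by rewrite !mem_boxes /= ltnn => /(_ lt_i).
have sub : {subset boxes (val beta) <= boxes (val nu)}.
  by move=> b; rewrite !mem_boxes => /leq_trans; apply.
split; first exact/allP.
rewrite size_filter -(eqn_add2l m); apply/eqP; rewrite addn1.
have := count_predC (mem (boxes (val beta))) (boxes (val nu)).
rewrite size_boxes partn_sum => e; rewrite -[RHS]e; congr addn.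
rewrite -size_filter -[LHS](partn_sum beta) -size_boxes; apply/perm_size/uniq_perm.
- exact: boxes_uniq.
- by rewrite filter_uniq ?boxes_uniq.
by move=> b; rewrite mem_filter /=; case: (boolP (b \in _)) => //= /sub->.
Qed.

Lemma skew_contentE m (beta : intpartn m) (nu : intpartn m.+1) :
  adds_box (val beta) (val nu) -> skew_content (val nu) (val beta) =
    \sum_(b <- boxes (val nu)) content b - \sum_(b <- boxes (val beta)) content b.
Proof.
move=> /andP[/allP sub _]; apply/eqP; rewrite eq_sym subr_eq; apply/eqP.
rewrite (bigID (mem (boxes (val beta)))) /= addrC /skew_content /skew_boxes.
rewrite big_filter; congr (_ + _); rewrite -big_filter; apply: perm_big.
apply: uniq_perm; rewrite ?filter_uniq ?boxes_uniq // => b.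
by rewrite mem_filter /=; case: (boolP (b \in boxes (val beta))) => //= /sub->.
Qed.

(** Inserting this 1 into a cardinality turns the counting of covers in Young's lattice into a sum
    over the row that receives the box. *)
Lemma adds_box_row K m (beta : intpartn m) (nu : intpartn m.+1) : (m < K)%N ->
  adds_box (val beta) (val nu) ->
  (\sum_(i < K) (nth 0 (val nu) i == (nth 0 (val beta) i).+1))%N = 1%N.
Proof.
move=> lt_mK /adds_boxP le_bn.
have s1 : (\sum_(i < K) (nth 0 (val nu) i - nth 0 (val beta) i))%N = 1%N.
  by rewrite sumnB // !partn_bigsum // ?subSnn // ltnW.
rewrite -[RHS]s1; apply: eq_bigr => i _.
have : (nth 0 (val nu) i - nth 0 (val beta) i <= 1)%N.
  by rewrite -[X in (_ <= X)%N]s1 (bigD1 i) //= leq_addr.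
by have := le_bn i; case: eqP => /=; lia.
Qed.

Lemma adds_box_shape K m (beta : intpartn m) (nu : intpartn m.+1) (i : 'I_K) :
  (m < K)%N ->
  adds_box (val beta) (val nu) && (nth 0 (val nu) i == (nth 0 (val beta) i).+1)%N =
  has_shape K (fun j => nth 0 (val beta) j + (j == i))%N nu.
Proof.
move=> lt_mK; have sumS : (\sum_(j < K) (nth 0 (val beta) j + (j == i :> nat)))%N = m.+1.
  rewrite big_split /= partn_bigsum ?(ltnW lt_mK) // (bigD1 i) //= eqxx big1 ?addn1 //.
  by move=> j jNi; case: eqP => // /ord_inj/eqP; rewrite (negPf jNi).
have f0 j : (K <= j)%N -> (nth 0 (val beta) j + (j == i :> nat))%N = 0%N.
  move=> le_j; rewrite partn_nth0 ?(leq_trans (ltnW lt_mK)) // gtn_eqF //.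
  exact: leq_trans (ltn_ord i) le_j.
apply/andP/(has_shapeP nu lt_mK f0) => [[/adds_boxP le_bn /eqP e] j|e].
  have [lt_j|le_j] := ltnP j K; last by rewrite f0 // partn_nth0 // (leq_trans lt_mK).
  apply/esym; apply: (@leq_sum_eq K (fun j => nth 0 (val beta) j + (j == i))%N
    (nth 0%N (val nu))) => //= [k lt_k|].
    by case: eqP => [->|_]; rewrite ?addn1 ?e // addn0.
  by rewrite sumS partn_bigsum.
split; last by rewrite e eqxx addn1.
by apply/adds_boxP => j; rewrite e leq_addr.
Qed.

Lemma card_up K m (beta : intpartn m) : (m < K)%N ->
  #|[set nu : intpartn m.+1 | adds_box (val beta) (val nu)]| =
  (\sum_(i < K) ((i == 0 :> nat) || (nth 0 (val beta) i < nth 0 (val beta) i.-1)))%N.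
Proof.
move=> lt_mK; rewrite -sum1_card.
under eq_bigr => nu Unu.
  rewrite inE in Unu; rewrite -(adds_box_row lt_mK Unu); over.
rewrite exchange_big; apply: eq_bigr => i _ /=.
transitivity #|[set nu : intpartn m.+1 |
    has_shape K (fun j => nth 0 (val beta) j + (j == i))%N nu]|.
  rewrite -sum1_card; under [RHS]eq_bigl => nu do rewrite inE -adds_box_shape //.
  rewrite big_mkcondr /=; apply: eq_big => [nu|nu _]; first by rewrite inE.
  by case: eqP.
have sumS : (\sum_(j < K) (nth 0 (val beta) j + (j == i :> nat)))%N = m.+1.
  rewrite big_split /= partn_bigsum ?(ltnW lt_mK) // (bigD1 i) //= eqxx big1 ?addn1 //.
  by move=> j jNi; case: eqP => // /ord_inj/eqP; rewrite (negPf jNi).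
rewrite card_shape // => [|j le_j]; last first.
  by rewrite partn_nth0 ?(leq_trans (ltnW lt_mK)) // gtn_eqF // (leq_trans (ltn_ord i)).
congr nat_of_bool; apply/forallP/idP => [le_f|addi j].
  case: (posnP i) => //= i0; have lt_i : (i.-1 < K)%N by rewrite (leq_ltn_trans (leq_pred _)).
  by have := le_f (Ordinal lt_i); rewrite /= prednK // eqxx addn1; lia.
have := partn_leS beta j; case: (eqVneq j.+1 i) => [e|]; last by lia.
by move: addi; rewrite -e /=; lia.
Qed.

Lemma card_down K m (beta : intpartn m.+1) : (m < K)%N ->
  #|[set gamma : intpartn m | adds_box (val gamma) (val beta)]| =
  (\sum_(i < K) (nth 0 (val beta) i.+1 < nth 0 (val beta) i))%N.
Proof.
move=> lt_mK; rewrite -sum1_card.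
under eq_bigr => nu Unu.
  rewrite inE in Unu; rewrite -(adds_box_row lt_mK Unu); over.
rewrite exchange_big; apply: eq_bigr => i _ /=.
(* Subtraction is truncated, so removing a box from an empty row would change nothing; such a row is
   set aside. *)
have [b0|b0] := posnP (nth 0%N (val beta) i).
  by rewrite b0 big1 // => gamma _; case: eqP.
transitivity #|[set nu : intpartn m |
    has_shape K (fun j => nth 0 (val beta) j - (j == i))%N nu]|.
  rewrite -sum1_card; under [RHS]eq_bigl => nu.
    rewrite inE.
    have -> : has_shape K (fun j => nth 0 (val beta) j - (j == i))%N nu =
      has_shape K (fun j => nth 0 (val nu) j + (j == i))%N beta.
      apply/forallP/forallP => e j; apply/eqP; move/eqP: (e j).
        by case: (eqVneq (j : nat) i) => [->|_]; lia.
      by case: (eqVneq (j : nat) i) => [->|_]; lia.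
    rewrite -adds_box_shape //; over.
  rewrite big_mkcondr /=; apply: eq_big => [nu|nu _]; first by rewrite inE.
  by case: eqP.
have sumS : (\sum_(j < K) (nth 0 (val beta) j - (j == i :> nat)))%N = m.
  rewrite sumnB => [|j _]; last by case: eqP => //= ->.
  rewrite partn_bigsum // (bigD1 i) //= eqxx big1 ?addn0 ?subn1 //.
  by move=> j jNi; case: eqP => // /ord_inj/eqP; rewrite (negPf jNi).
rewrite card_shape ?(ltnW lt_mK) // => [|j le_j]; last first.
  by rewrite partn_nth0 ?(leq_trans lt_mK).
congr nat_of_bool; apply/forallP/idP => [/(_ i)|addi j].
  by rewrite eqxx gtn_eqF // subn0 subn1 -ltnS prednK.
have := partn_leS beta j; case: (eqVneq (j : nat) i) => [->|_ le_j].
  by rewrite gtn_eqF // subn0 subn1 => _; rewrite -ltnS prednK.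
by rewrite subn0 (leq_trans (leq_subr _ _)).
Qed.

(** Distinct shapes have at most one common cover, the rowwise maximum J, and at most one common
    predecessor, the rowwise minimum M. Their sizes add up to twice m+1, so J has size m+2 exactly
    when M has size m. For equal shapes there is one more addable row than removable rows. *)
Lemma card_up_down m (beta beta' : intpartn m.+1) :
  #|[set nu : intpartn m.+2 | adds_box (val beta) (val nu) && adds_box (val beta') (val nu)]|
  = (#|[set gamma : intpartn m | adds_box (val gamma) (val beta) &&
       adds_box (val gamma) (val beta')]| + (beta == beta'))%N.
Proof.
have [<-|bNb'] := eqVneq beta beta'.
  transitivity #|[set nu : intpartn m.+2 | adds_box (val beta) (val nu)]|.
    by apply: eq_card => nu; rewrite !inE andbb.
  (* Row 0 always accepts a box, and row i+1 accepts one exactly when row i can lose one. *)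
  rewrite (@card_up m.+2) // big_ord_recl /= addnC; congr addn.
  transitivity #|[set gamma : intpartn m | adds_box (val gamma) (val beta)]|.
    by rewrite (@card_down m.+1).
  by apply: eq_card => nu; rewrite !inE andbb.
rewrite addn0.
set a := nth 0%N (val beta); set b := nth 0%N (val beta').
pose J i := maxn (a i) (b i); pose M i := minn (a i) (b i).
have aS := partn_leS beta : forall i, (a i.+1 <= a i)%N.
have bS := partn_leS beta' : forall i, (b i.+1 <= b i)%N.
have a0 i : (m.+1 <= i)%N -> a i = 0%N by apply: partn_nth0.
have b0 i : (m.+1 <= i)%N -> b i = 0%N by apply: partn_nth0.
pose K := m.+2.
have sa : (\sum_(i < K) a i)%N = m.+1 by apply: partn_bigsum.
have sb : (\sum_(i < K) b i)%N = m.+1 by apply: partn_bigsum.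
have sJM : (\sum_(i < K) J i + \sum_(i < K) M i = m.+1 + m.+1)%N.
  rewrite -big_split /= -{1}sa -sb -big_split /=; apply: eq_bigr => i _.
  by rewrite /J /M; lia.
have J0 i : (K <= i)%N -> J i = 0%N by move=> le_i; rewrite /J a0 ?b0 // ltnW.
have M0 i : (K <= i)%N -> M i = 0%N by move=> le_i; rewrite /M a0 ?b0 // ltnW.
have JS i : (J i.+1 <= J i)%N by have := aS i; have := bS i; rewrite /J; lia.
have MS i : (M i.+1 <= M i)%N by have := aS i; have := bS i; rewrite /M; lia.
(* A maximum with at most m+1 boxes would coincide with both shapes. *)
have sJ : (m.+2 <= \sum_(i < K) J i)%N.
  rewrite ltnNge; apply: contra bNb' => sJ; apply/eqP/partn_inj => i.
  have [lt_i|le_i] := ltnP i K; last by rewrite -/(a i) -/(b i) a0 ?b0 // ltnW.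
  transitivity (J i); last symmetry.
    by apply: (@leq_sum_eq K a J) => // [j _|]; rewrite ?sa ?leq_maxl.
  by apply: (@leq_sum_eq K b J) => // [j _|]; rewrite ?sb ?leq_maxr.
have upE (nu : intpartn m.+2) : adds_box (val beta) (val nu) && adds_box (val beta') (val nu) =
    (\sum_(i < K) J i == m.+2)%N && has_shape K J nu.
  have hP := @has_shapeP K m.+2 J nu (leqnn _) J0.
  apply/andP/andP => [[/adds_boxP le_a /adds_boxP le_b]|[_ /hP e]].
    have le_J i : (J i <= nth 0 (val nu) i)%N by rewrite geq_max le_a le_b.
    have sJ' : (\sum_(i < K) J i)%N = m.+2.
      apply/eqP; rewrite eqn_leq sJ andbT -[X in (_ <= X)%N](partn_bigsum nu (leqnn _)).
      by apply: leq_sum.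
    rewrite sJ'; split=> //; apply/forallP=> i; rewrite eq_sym; apply/eqP.
    by apply: (@leq_sum_eq K J (nth 0%N (val nu))) => //; rewrite sJ' partn_bigsum.
  by split; apply/adds_boxP => i; rewrite e ?leq_maxl ?leq_maxr.
have downE (gamma : intpartn m) : adds_box (val gamma) (val beta) &&
  adds_box (val gamma) (val beta') =
    (\sum_(i < K) J i == m.+2)%N && has_shape K M gamma.
  have hP := @has_shapeP K m M gamma (leq_addl 2 m) M0.
  apply/andP/andP => [[/adds_boxP le_a /adds_boxP le_b]|[_ /hP e]]; last first.
    by split; apply/adds_boxP => i; rewrite e ?geq_minl ?geq_minr.
  have le_M i : (nth 0 (val gamma) i <= M i)%N by rewrite leq_min le_a le_b.
  have sM : (m <= \sum_(i < K) M i)%N.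
    rewrite -[X in (X <= _)%N](@partn_bigsum _ gamma K (leq_addl 2 m)).
    by apply: leq_sum.
  have sM' : (\sum_(i < K) M i)%N = m by lia.
  split; first by apply/eqP; lia.
  apply/forallP=> i; apply/eqP.
  by apply: (@leq_sum_eq K (nth 0%N (val gamma)) M) => //;
    rewrite sM' (partn_bigsum gamma (leq_addl 2 m)).
rewrite (eq_card (B := [set nu | (\sum_(i < K) J i == m.+2)%N && has_shape K J nu])); last first.
  by move=> nu; rewrite !inE upE.
rewrite [RHS](eq_card (B := [set nu | (\sum_(i < K) J i == m.+2)%N && has_shape K M nu]));
  last first.
  by move=> nu; rewrite !inE downE.
have [sJ'|_] := eqVneq; last by rewrite !eq_card0 // => nu; rewrite inE.
rewrite !card_shape //; last by lia.
- by congr nat_of_bool; apply/forallP/forallP => _ i; rewrite ?JS ?MS.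
- exact: leq_addl 2 m.
Qed.

End Shapes.

(** * Columns of a diagram and counts of boxes *)

Section ColumnHeights.
Variable m : nat.
Implicit Types nu : intpartn m.

Lemma ltn_colheight nu i j :
  (j < nth 0 (val nu) i)%N = (i < count (ltn j) (val nu))%N.
Proof.
case/and3P: (valP nu) => srt _ _; elim: (val nu) srt i => [|x s IH] srt i.
  by rewrite nth_nil.
have xs : all (geq x) s.
  by apply: order_path_min srt => a b c /= le_ab le_ca; apply: leq_trans le_ca le_ab.
have {}IH := IH (path_sorted srt).
have [lt_j|le_j] := ltnP j x; first by case: i => [|i] /=; rewrite ?IH /= lt_j.
rewrite /= [(j < x)%N]ltnNge le_j add0n (_ : count _ s = 0%N) ?ltn0; last first.
  apply/eqP; rewrite -leqn0 leqNgt -has_count; apply/hasPn => y /(allP xs) /=; lia.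
apply/negbTE; rewrite -leqNgt; case: i => [|i] //=.
have [lt_i|le_i] := ltnP i (size s); last by rewrite nth_default.
by apply: leq_trans le_j; apply: (allP xs); rewrite mem_nth.
Qed.

(** Serves to identify two shapes once tableaux with the same columns have been found. *)
Lemma partn_eq_cols nu nu' :
  (forall j, count (fun b => b.2 == j) (boxes (val nu)) =
             count (fun b => b.2 == j) (boxes (val nu'))) -> nu = nu'.
Proof.
move=> e; have lt_iff i j : (j < nth 0 (val nu) i)%N = (j < nth 0 (val nu') i)%N.
  by rewrite !ltn_colheight -!count_boxes_col e.
apply: partn_inj => i; apply/eqP; rewrite eqn_leq; apply/andP; split.
  by rewrite leqNgt lt_iff ltnn.
by rewrite leqNgt -lt_iff ltnn.
Qed.

Lemma count_row_lt nu b : b \in boxes (val nu) ->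
  count (fun b' => (b'.1 == b.1) && (b'.2 < b.2)%N) (boxes (val nu)) = b.2.
Proof.
case: b => r c bin; rewrite -[RHS](size_iota 0) -(size_map (pair r)) -size_filter /=.
apply/perm_size/uniq_perm; rewrite ?filter_uniq ?boxes_uniq //.
  by rewrite map_inj_uniq ?iota_uniq // => x y [].
move=> [i j]; rewrite mem_filter /=; apply/andP/mapP => [[/andP[/eqP-> lt_j] _]|[k]].
  by exists j; rewrite // mem_iota.
rewrite mem_iota /= => lt_k [-> ->]; rewrite eqxx lt_k; split=> //.
by move: bin; rewrite !mem_boxes /=; apply: ltn_trans.
Qed.

Lemma count_col_lt nu b : b \in boxes (val nu) ->
  count (fun b' => (b'.2 == b.2) && (b'.1 < b.1)%N) (boxes (val nu)) = b.1.
Proof.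
case: b => r c bin; rewrite -[RHS](size_iota 0) -(size_map (pair^~ c)) -size_filter /=.
apply/perm_size/uniq_perm; rewrite ?filter_uniq ?boxes_uniq //.
  by rewrite map_inj_uniq ?iota_uniq // => x y [].
move=> [i j]; rewrite mem_filter /=; apply/andP/mapP => [[/andP[/eqP-> lt_j] _]|[k]].
  by exists i; rewrite // mem_iota.
rewrite mem_iota /= => lt_k [-> ->]; rewrite eqxx lt_k; split=> //.
move: bin; rewrite !mem_boxes /= => /leq_trans; apply.
by apply: partn_le; apply: ltnW.
Qed.

Lemma count_row nu r : count (fun b => b.1 == r) (boxes (val nu)) = nth 0%N (val nu) r.
Proof.
rewrite -[RHS](size_iota 0) -(size_map (pair r)) -size_filter /=.
apply/perm_size/uniq_perm; rewrite ?filter_uniq ?boxes_uniq //.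
  by rewrite map_inj_uniq ?iota_uniq // => x y [].
move=> [i j]; rewrite mem_filter mem_boxes /=.
apply/andP/mapP => [[/eqP-> lt_j]|[k]]; first by exists j; rewrite // mem_iota.
by rewrite mem_iota /= => lt_k [-> ->].
Qed.

End ColumnHeights.

Section HalfCount.
Variables (I : finType) (D : pred I) (r : rel I).
Hypothesis r_sym : symmetric r.

(** With r the relation of lying in one row and u the column index, each box of a tableau
    contributes its column, so the total is the sum of the columns. Its double depends only on r,
    which allows another u to be substituted. *)
Definition inversions (u : I -> nat) : nat :=
  (\sum_(k | D k) \sum_(k' | D k') (r k k' && (u k' < u k)))%N.

(* Of the two orderings of a pair of related elements, u picks exactly one. *)
Lemma inversions_double (u : I -> nat) :
  {in D &, forall k k', r k k' -> u k = u k' -> k = k'} ->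
  (inversions u).*2 = (\sum_(k | D k) \sum_(k' | D k') (r k k' && (k' != k)))%N.
Proof.
move=> u_inj; rewrite -addnn {2}/inversions exchange_big -big_split /=.
apply: eq_bigr => k Dk; rewrite -big_split /=; apply: eq_bigr => k' Dk'.
rewrite [r k' k]r_sym; case: (boolP (r k k')) => //= rkk'.
have [->|kNk'] := eqVneq k' k; first by rewrite ltnn.
have := u_inj _ _ Dk Dk' rkk'; case: ltngtP => // e /(_ (esym e)) e'.
by rewrite e' eqxx in kNk'.
Qed.

End HalfCount.

(** * Tableaux *)

Section Tableaux.
Variables (N m : nat).
Hypothesis le_mN : (m <= N)%N.
Implicit Types (t u : 'I_N -> nat * nat) (nu : intpartn m) (i j k : 'I_N).

(** A bijective filling with no order condition. Only the entries below m count, so that tableaux of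
    all sizes share the index type ['I_N]. *)
Definition is_tableau nu t : Prop :=
  {in [pred k : 'I_N | k < m] &, injective t}%N /\
  forall k, (k < m)%N -> t k \in boxes (val nu).

Definition low : seq 'I_N := [seq k : 'I_N <- enum 'I_N | (k < m)%N].

Lemma mem_low k : (k \in low) = (k < m)%N.
Proof. by rewrite mem_filter mem_enum andbT. Qed.

Lemma low_uniq : uniq low. Proof. by rewrite filter_uniq ?enum_uniq. Qed.

Lemma big_low (R : Type) (idx : R) (op : SemiGroup.com_law R) (F : 'I_N -> R) :
  \big[op/idx]_(k <- low) F k = \big[op/idx]_(k : 'I_N | (k < m)%N) F k.
Proof. by rewrite big_filter big_enum_cond. Qed.

Lemma size_low : size low = m.
Proof.
rewrite -sum1_size big_filter big_enum_cond /=.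
by rewrite -(big_ord_widen N (fun=> 1%N) le_mN) sum_nat_const card_ord muln1.
Qed.

Lemma perm_tableau nu t : is_tableau nu t -> perm_eq (map t low) (boxes (val nu)).
Proof.
move=> [t_inj t_in]; have tu : uniq (map t low).
  by rewrite map_inj_in_uniq ?low_uniq // => i j; rewrite !mem_low => *; apply: t_inj.
have sub : {subset map t low <= boxes (val nu)}.
  by move=> _ /mapP[k + ->]; rewrite mem_low => /t_in.
have le_size : (size (boxes (val nu)) <= size (map t low))%N.
  by rewrite size_map size_low size_boxes partn_sum.
by have [_ e] := uniq_min_size tu sub le_size; apply: uniq_perm; rewrite ?boxes_uniq.
Qed.

Lemma tableau_onto nu t b : is_tableau nu t -> b \in boxes (val nu) ->
  exists2 k : 'I_N, (k < m)%N & t k = b.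
Proof.
move=> /perm_tableau/perm_mem <- /mapP[k]; rewrite mem_low => lt_k ->.
by exists k.
Qed.

Lemma big_tableau (R : Type) (idx : R) (op : Monoid.com_law idx) nu t
    (F : nat * nat -> R) : is_tableau nu t ->
  \big[op/idx]_(k : 'I_N | (k < m)%N) F (t k) = \big[op/idx]_(b <- boxes (val nu)) F b.
Proof.
by move=> tt; rewrite -(perm_big _ (perm_tableau tt)) big_map big_low.
Qed.

Lemma count_tableau nu t (p : pred (nat * nat)) : is_tableau nu t ->
  (\sum_(k : 'I_N | (k < m)%N) p (t k))%N = count p (boxes (val nu)).
Proof.
move=> tt; rewrite (big_tableau _ (fun b => p b : nat) tt) -sum1_count.
by rewrite [RHS]big_mkcond; apply: eq_bigr => b _; case: (p b).
Qed.

Lemma tableau_inj_row nu t : is_tableau nu t ->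
  {in [pred k : 'I_N | k < m]%N &, forall k k',
     (t k).1 == (t k').1 -> (t k).2 = (t k').2 -> k = k'}.
Proof.
move=> [t_inj _] k k' lt_k lt_k' /eqP e1 e2; apply: t_inj => //.
by rewrite [t k]surjective_pairing e1 e2 -surjective_pairing.
Qed.

Lemma tableau_inj_col nu t : is_tableau nu t ->
  {in [pred k : 'I_N | k < m]%N &, forall k k',
     (t k).2 == (t k').2 -> (t k).1 = (t k').1 -> k = k'}.
Proof.
by move=> tt k k' lt_k lt_k' e2 e1; apply: (tableau_inj_row tt); rewrite ?e1 //; apply/eqP.
Qed.

Definition same_row t i j := (t i).1 == (t j).1.
Definition same_col t i j := (t i).2 == (t j).2.

Lemma inversions_row nu t : is_tableau nu t ->
  inversions [pred k : 'I_N | k < m]%N (same_row t) (fun k => (t k).2) =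
  (\sum_(b <- boxes (val nu)) b.2)%N.
Proof.
move=> tt; rewrite -(big_tableau _ (fun b => b.2) tt).
apply: eq_bigr => k lt_k; rewrite -[RHS](count_row_lt (tt.2 k lt_k)).
rewrite -(count_tableau _ tt); apply: eq_bigr => k' _.
by rewrite /same_row eq_sym.
Qed.

Lemma inversions_col nu t : is_tableau nu t ->
  inversions [pred k : 'I_N | k < m]%N (same_col t) (fun k => (t k).1) =
  (\sum_(b <- boxes (val nu)) b.1)%N.
Proof.
move=> tt; rewrite -(big_tableau _ (fun b => b.1) tt).
apply: eq_bigr => k lt_k; rewrite -[RHS](count_col_lt (tt.2 k lt_k)).
rewrite -(count_tableau _ tt); apply: eq_bigr => k' _.
by rewrite /same_col eq_sym.
Qed.

Definition collision t u : bool :=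
  [exists i : 'I_N, exists j : 'I_N,
     [&& (i < m)%N, (j < m)%N, i != j, same_row t i j & same_col u i j]].

Definition mixed t u k := ((t k).1, (u k).2).

(* In each row of t, the columns given by u are distinct, so the number of
   smaller ones is at most the column itself; summing, the total column weight
   of u is at least that of t, and equality forces the rows to be filled. *)
Lemma mixed_tableau la mu t u : is_tableau la t -> is_tableau mu u ->
  (\sum_(b <- boxes (val mu)) b.2 <= \sum_(b <- boxes (val la)) b.2)%N ->
  ~~ collision t u -> la = mu /\ is_tableau la (mixed t u).
Proof.
move=> tt tu le_w ncol.
have sep : {in [pred k : 'I_N | k < m]%N &, forall k k',
    same_row t k k' -> (u k).2 = (u k').2 -> k = k'}.
  move=> i j lt_i lt_j ij uij; apply/eqP; apply: contraNT ncol => iNj.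
  by apply/existsP; exists i; apply/existsP; exists j; apply/and5P; split=> //; apply/eqP.
pose rk k := (\sum_(k' : 'I_N | (k' < m)%N) (same_row t k k' && ((u k').2 < (u k).2)))%N.
have rk_seq k : rk k = size [seq (u k').2 | k' <- low & same_row t k k' && ((u k').2 < (u k).2)%N].
  rewrite size_map size_filter -sum1_count /rk -big_low [RHS]big_mkcond.
  by apply: eq_bigr => k' _; case: (_ && _).
have rk_sub k : {subset [seq (u k').2 | k' <- low & same_row t k k' && ((u k').2 < (u k).2)%N]
    <= iota 0 (u k).2}.
  by move=> _ /mapP[k' + ->]; rewrite mem_filter mem_iota => /andP[/andP[]].
have rk_uniq k : uniq [seq (u k').2 | k' <- low & same_row t k k' && ((u k').2 < (u k).2)%N].
  rewrite map_inj_in_uniq ?(filter_uniq _ low_uniq) // => i j.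
  rewrite (mem_filter _ i) (mem_filter _ j) !mem_low =>
    /andP[/andP[ki _] lt_i] /andP[/andP[kj _] lt_j].
  by apply: sep => //; rewrite /same_row -(eqP ki).
have rk_le k : (rk k <= (u k).2)%N.
  by rewrite rk_seq -[X in (_ <= X)%N](size_iota 0); apply: uniq_leq_size.
have rk_eq k : (k < m)%N -> rk k = (u k).2.
  (* The columns of u and those of t both separate the entries of each row of t, so the two
     inversion counts have the same double. *)
  have s_rk : (\sum_(k : 'I_N | k < m) rk k)%N = (\sum_(b <- boxes (val la)) b.2)%N.
    rewrite -(inversions_row tt); apply: double_inj.
    rewrite [RHS]inversions_double; last exact: tableau_inj_row tt.
      rewrite -[LHS]/(inversions _ _ (fun k => (u k).2)).*2 inversions_double //.
      by move=> i j; rewrite /same_row eq_sym.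
    by move=> i j; rewrite /same_row eq_sym.
  move: le_w; rewrite -s_rk -(big_tableau _ (fun b => b.2) tu) => le_w lt_k.
  apply/eqP; rewrite eqn_leq rk_le leqNgt; apply/negP=> lt_rk.
  move: le_w; rewrite leqNgt => /negP; apply.
  rewrite (bigD1 k) //= [X in (_ < X)%N](bigD1 k) //= -addSn leq_add //.
  exact: leq_sum.
have tm : is_tableau la (mixed t u).
  split=> [i j lt_i lt_j [e1 e2]|k lt_k]; first by apply: sep => //; apply/eqP.
  rewrite mem_boxes /= -rk_eq // -count_row -(count_tableau _ tt).
  rewrite /rk (bigD1 k) //= ltnn andbF add0n [X in (_ < X)%N](bigD1 k) //= eqxx.
  rewrite add1n ltnS leq_sum // => i _; rewrite /same_row eq_sym.
  by case: eqP => //; case: (_ < _)%N.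
split=> //; apply: partn_eq_cols => j.
by rewrite -(count_tableau _ tm) -(count_tableau _ tu).
Qed.

End Tableaux.

(** * Young symmetrizers *)

Section SymLow.
Variable N : nat.
Implicit Types (m : nat) (g h : 'S_N) (i j k : 'I_N) (f : 'I_N -> nat).

(** One construction for three kinds of groups: f constant gives S_m, and f the row or column index
    gives the row or column group of a tableau. *)
Definition pres m f : {set 'S_N} :=
  [set g : 'S_N | [forall k : 'I_N, ((m <= k)%N ==> (g k == k)) && (f (g k) == f k)]].

Lemma presP m f g : reflect ((forall k, (m <= k)%N -> g k = k) /\ forall k, f (g k) = f k)
  (g \in pres m f).
Proof.
rewrite inE; apply: (iffP forallP) => [e|[e1 e2] k].
  by split=> [k le_k|k]; have := e k; rewrite ?le_k => /andP[/eqP + /eqP].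
by rewrite e2 eqxx andbT; apply/implyP => /e1->.
Qed.

Lemma pres_group_set m f : group_set (pres m f).
Proof.
apply/group_setP; split=> [|g h /presP[g1 g2] /presP[h1 h2]].
  by apply/presP; split=> k; rewrite perm1.
by apply/presP; split=> k => [le_k|]; rewrite permM; [rewrite g1 ?h1|rewrite h2 g2].
Qed.
Canonical pres_group m f := Group (pres_group_set m f).

Definition lowSym m : {group 'S_N} := pres_group m (fun=> 0%N).

Lemma lowSymP m g : reflect (forall k, (m <= k)%N -> g k = k) (g \in lowSym m).
Proof. by apply: (iffP (presP _ _ _)) => [[]|]. Qed.

Lemma pres_sub m f : pres m f \subset lowSym m.
Proof. by apply/fintype.subsetP => g /presP[g1 _]; apply/lowSymP. Qed.

Lemma lowSym_sub m m' : (m <= m')%N -> lowSym m \subset lowSym m'.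
Proof.
by move=> le_m; apply/fintype.subsetP => g /lowSymP g1; apply/lowSymP => k /(leq_trans le_m)/g1.
Qed.

Lemma lowSym_full : lowSym N = [set: 'S_N]%G.
Proof.
by apply/group_inj/setP => g; rewrite in_setT; apply/lowSymP => k; rewrite leqNgt ltn_ord.
Qed.

Lemma lowSym_lt m g k : g \in lowSym m -> (g k < m)%N = (k < m)%N.
Proof.
move=> /lowSymP g1; apply/idP/idP; rewrite !ltnNge; apply: contra => le_k; first by rewrite g1.
by rewrite -(perm_inj (g1 _ le_k)).
Qed.

Lemma tperm_pres m f i j : (i < m)%N -> (j < m)%N -> f i = f j -> tperm i j \in pres m f.
Proof.
move=> lt_i lt_j fij; apply/presP; split=> k => [le_k|]; last by case: tpermP => // ->.
by rewrite tpermD //; apply/eqP => e; rewrite -e leqNgt ?lt_i ?lt_j in le_k.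
Qed.

Lemma tperm_lowSym m i j : (i < m)%N -> (j < m)%N -> tperm i j \in lowSym m.
Proof. by move=> lt_i lt_j; apply: tperm_pres. Qed.

Lemma eq_pres m f f' : (forall k, (k < m)%N -> f k = f' k) -> pres m f = pres m f'.
Proof.
move=> e; apply/setP => g; apply/presP/presP => -[g1 g2]; split=> // k.
  have [lt_k|le_k] := ltnP k m; last by rewrite g1.
  by rewrite -!e ?g2 // (lowSym_lt k (introT (lowSymP m g) g1)).
have [lt_k|le_k] := ltnP k m; last by rewrite g1.
by rewrite !e ?g2 // (lowSym_lt k (introT (lowSymP m g) g1)).
Qed.

Lemma pres_conj m f p g : p \in lowSym m ->
  (g \in pres m (fun k => f (p k))) = (g ^ p \in pres m f)%g.
Proof.
move=> Sp; have /lowSymP p1 := Sp.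
have p1' k : (m <= k)%N -> (p^-1)%g k = k by apply/lowSymP; rewrite groupV.
apply/presP/presP => -[g1 g2]; split=> k.
- by move=> le_k; rewrite /conjg !permM p1' // g1 // p1.
- by rewrite /conjg !permM g2 permKV.
- by move=> le_k; apply: (@perm_inj _ p); rewrite -[g k]/(g k) -permJ ?p1 ?g1.
- by rewrite -permJ g2.
Qed.

Lemma card_lowSym m : (m <= N)%N -> #|lowSym m| = m`!.
Proof.
move=> le_m; have cA : #|[set k : 'I_N | (k < m)%N]| = m.
  rewrite -[RHS](size_low le_m) -(card_uniqP (low_uniq N m)); apply: eq_card => k.
  by rewrite inE mem_low.
rewrite -{2}cA -card_perm; apply: eq_card => g; apply/lowSymP/fintype.subsetP => [g1 k|g1 k le_k].
  by rewrite !inE ltnNge; apply: contra => /g1->.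
by apply/eqP; apply: contraLR le_k => gk; have := g1 k gk; rewrite inE -ltnNge.
Qed.
End SymLow.

(** * Sums over a subgroup with trivial or sign character *)

Section SignedSums.
Variables (C : numClosedFieldType) (N : nat).
Local Notation A := (gring C 'S_N).
Implicit Types (s : bool) (K : {group 'S_N}) (g h p q : 'S_N).

Definition eps s g : C := (-1) ^+ (s && odd_perm g).
Definition ysum s (K : {set 'S_N}) : A := \sum_(g in K) eps s g *: gdelta g.

Lemma epsM s g h : eps s (g * h)%g = eps s g * eps s h.
Proof. by rewrite /eps odd_permM; case: s => /=; rewrite ?mulr1 // signr_addb. Qed.
Lemma eps1 s : eps s 1%g = 1.
Proof. by rewrite /eps odd_perm1 andbF. Qed.
Lemma epsV s g : eps s g^-1%g = eps s g.
Proof. by rewrite /eps odd_permV. Qed.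
Lemma eps_sq s g : eps s g * eps s g = 1.
Proof. by rewrite -{1}epsV -epsM mulVg eps1. Qed.
Lemma eps_conj s g : (eps s g)^* = eps s g.
Proof. by rewrite /eps rmorph_sign. Qed.

Lemma ysumE s (K : {set 'S_N}) g : ysum s K g = if g \in K then eps s g else 0.
Proof.
rewrite gring_sumE; case: ifPn => gK.
  rewrite (bigD1 g) //= gringZE gdeltaE eqxx mulr1 big1 ?addr0 // => h /andP[_ hNg].
  by rewrite gringZE gdeltaE eq_sym (negPf hNg) mulr0.
rewrite big1 // => h hK; rewrite gringZE gdeltaE; case: eqP => [e|_]; last by rewrite mulr0.
by rewrite e hK in gK.
Qed.

Lemma gsupp_ysum s (K : {set 'S_N}) : gsupp K (ysum s K).
Proof. by apply/gsuppP => g /negPf gK; rewrite ysumE gK. Qed.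

Lemma gstar_ysum s K : gstar (ysum s K) = ysum s K.
Proof.
by apply/gringP => g; rewrite gstarE !ysumE groupV; case: ifP;
  rewrite ?rmorph0 // eps_conj epsV.
Qed.

Lemma gdelta_ysum s K g : g \in K -> gdelta g * ysum s K = eps s g *: ysum s K.
Proof.
move=> gK; apply/gringP => h; rewrite gdelta_mulE gringZE !ysumE groupMl ?groupV //.
by case: ifP; rewrite ?mulr0 // epsM epsV.
Qed.

Lemma ysum_gdelta s K g : g \in K -> ysum s K * gdelta g = eps s g *: ysum s K.
Proof.
move=> gK; apply/gringP => h; rewrite gmul_deltaE gringZE !ysumE groupMr ?groupV //.
by case: ifP; rewrite ?mulr0 // epsM epsV mulrC.
Qed.

Lemma ysum_sq s K : ysum s K * ysum s K = #|K|%:R *: ysum s K.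
Proof.
rewrite {1}/ysum mulr_suml -[RHS]/(#|K|%:R *: _) scaler_nat -sumr_const.
by apply: eq_bigr => g gK; rewrite -scalerAl gdelta_ysum // scalerA eps_sq scale1r.
Qed.

End SignedSums.

Section YoungSymmetrizer.
Variables (C : numClosedFieldType) (N m : nat).
Hypothesis le_mN : (m <= N)%N.
Local Notation A := (gring C 'S_N).
Implicit Types (t u : 'I_N -> nat * nat) (nu la mu : intpartn m) (g h p q : 'S_N).
Implicit Types (x y : A).

Definition rowg t := pres_group m (fun k : 'I_N => (t k).1).
Definition colg t := pres_group m (fun k : 'I_N => (t k).2).
Definition colsum t : A := ysum C true (colg t).
Definition rowsum t : A := ysum C false (rowg t).
Definition ysym t : A := colsum t * rowsum t.

Lemma row_tperm t (i j : 'I_N) : (i < m)%N -> (j < m)%N -> same_row t i j -> tperm i j \in rowg t.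
Proof. by move=> lt_i lt_j /eqP; apply: tperm_pres. Qed.

Lemma col_tperm t (i j : 'I_N) : (i < m)%N -> (j < m)%N -> same_col t i j -> tperm i j \in colg t.
Proof. by move=> lt_i lt_j /eqP; apply: tperm_pres. Qed.

Lemma colg_rowg nu t g : is_tableau nu t -> g \in colg t -> g \in rowg t -> g = 1%g.
Proof.
move=> [t_inj _] gc /presP[g1 g2]; have Sg := fintype.subsetP (pres_sub _ _) _ gc.
have /presP[_ g3] := gc.
apply/permP => k; rewrite perm1; have [lt_k|/g1//] := ltnP k m.
apply: t_inj; rewrite ?inE ?(lowSym_lt _ Sg) //.
by rewrite [LHS]surjective_pairing g2 g3 -surjective_pairing.
Qed.

Lemma gtau_ysym nu t : is_tableau nu t -> gtau (ysym t) = 1.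
Proof.
move=> tt; rewrite gtauM (bigD1 1%g) //= invg1 !ysumE !group1 !eps1 mulr1.
rewrite big1 ?addr0 // => g gN1; rewrite !ysumE groupV.
case: ifP => [gc|]; rewrite ?mul0r //; case: ifP => [gr|]; rewrite ?mulr0 //.
by rewrite (colg_rowg tt gc gr) eqxx in gN1.
Qed.

Lemma ysymMl t q : q \in colg t -> gdelta q * ysym t = eps C true q *: ysym t.
Proof. by move=> qc; rewrite mulrA gdelta_ysum // -scalerAl. Qed.

Lemma ysymMr t p : p \in rowg t -> ysym t * gdelta p = ysym t.
Proof. by move=> pr; rewrite -mulrA ysum_gdelta // /eps expr0 scale1r. Qed.

Lemma gsupp_rowsum t : gsupp (lowSym N m) (rowsum t).
Proof. by apply: gsuppS (gsupp_ysum _ _ _); apply: pres_sub. Qed.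

Lemma gsupp_colsum t : gsupp (lowSym N m) (colsum t).
Proof. by apply: gsuppS (gsupp_ysum _ _ _); apply: pres_sub. Qed.

Lemma gsupp_ysym t : gsupp (lowSym N m) (ysym t).
Proof. by rewrite gsuppM ?gsupp_rowsum ?gsupp_colsum. Qed.

Lemma ysym_notin t g : (forall q p, q \in colg t -> p \in rowg t -> g != (q * p)%g) ->
  ysym t g = 0.
Proof.
move=> gN; rewrite gmulE big1 // => h _; rewrite !ysumE.
case: ifP => [hc|]; rewrite ?mul0r //; case: ifP => [hr|]; rewrite ?mulr0 //.
by have := gN _ _ hc hr; rewrite mulKVg eqxx.
Qed.

Lemma ysym_in nu t q p : is_tableau nu t -> q \in colg t -> p \in rowg t ->
  ysym t (q * p)%g = eps C true q.
Proof.
move=> tt qc pr; have e1 : ysym t 1%g = 1 := gtau_ysym tt.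
rewrite -(ysymMr pr) gmul_deltaE mulgK.
have := congr1 (fun x : A => x q) (ysymMl qc).
rewrite gdelta_mulE gringZE mulVg e1 => /(congr1 ( *%R (eps C true q))).
by rewrite mulr1 mulrA eps_sq mul1r.
Qed.

Lemma tableau_perm nu t g : is_tableau nu t -> g \in lowSym N m ->
  is_tableau nu (fun k => t (g k)).
Proof.
move=> [t_inj t_in] Sg; split=> [i j lt_i lt_j e|k lt_k]; last by rewrite t_in ?(lowSym_lt _ Sg).
by apply: (@perm_inj _ g); apply: t_inj; rewrite ?inE ?(lowSym_lt _ Sg).
Qed.

Lemma tableau_trans nu t u : is_tableau nu t -> is_tableau nu u ->
  exists2 p, p \in lowSym N m & forall k : 'I_N, (k < m)%N -> u k = t (p k).
Proof.
move=> tt tu.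
(* [f k] is the entry that t puts in the box [u k]; the default k is never reached below m, because
   t fills every box. *)
pose f (k : 'I_N) : 'I_N := if (k < m)%N then
    odflt k [pick k' : 'I_N | (k' < m)%N && (t k' == u k)] else k.
have fP (k : 'I_N) : (k < m)%N -> (f k < m)%N /\ t (f k) = u k.
  move=> lt_k; rewrite /f lt_k; case: pickP => [k' /andP[lt_k' /eqP]//|none].
  have [k' lt_k' e] := tableau_onto le_mN tt (tu.2 k lt_k).
  by have := none k'; rewrite lt_k' e eqxx.
have f_hi (k : 'I_N) : (m <= k)%N -> f k = k by rewrite /f ltnNge => ->.
have f_inj : injective f.
  move=> i j; have [lt_i|le_i] := ltnP i m; have [lt_j|le_j] := ltnP j m.
  - by move=> e; apply: tu.1 => //; rewrite -(fP i lt_i).2 e (fP j lt_j).2.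
  - by rewrite (f_hi j) // => e; have := (fP i lt_i).1; rewrite e ltnNge le_j.
  - by rewrite (f_hi i) // => e; have := (fP j lt_j).1; rewrite -e ltnNge le_i.
  - by rewrite !f_hi.
exists (perm f_inj); first by apply/lowSymP => k /f_hi; rewrite permE.
by move=> k /fP[_ e]; rewrite permE.
Qed.

Lemma eq_ysym t u : (forall k : 'I_N, (k < m)%N -> t k = u k) -> ysym t = ysym u.
Proof.
move=> e; rewrite /ysym /colsum /rowsum /=.
by congr (ysum _ _ _ * ysum _ _ _); apply: eq_pres => k /e->.
Qed.

Lemma ysum_conj s f p : p \in lowSym N m ->
  ysum C s (pres m (fun k => f (p k))) = gdelta p * ysum C s (pres m f) * gdelta p^-1.
Proof.
move=> Sp; apply/gringP => g; rewrite gmul_deltaE gdelta_mulE !ysumE invgK pres_conj //.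
rewrite /conjg; case: ifP => // _.
by rewrite !epsM epsV mulrCA eps_sq mulr1.
Qed.

Lemma ysym_conj t p : p \in lowSym N m ->
  ysym (fun k => t (p k)) = gdelta p * ysym t * gdelta p^-1.
Proof.
move=> Sp; rewrite /ysym /colsum /rowsum /=.
rewrite (ysum_conj true (fun k => (t k).2) Sp) (ysum_conj false (fun k => (t k).1) Sp).
by rewrite !mulrA -[_ * gdelta p^-1%g * gdelta p]mulrA gdeltaVl mulr1.
Qed.

(* An element with the symmetries of ysym t is determined by its value at 1,
   since it vanishes at every h for which t and t o h^-1 collide. *)
Lemma ysym_unique nu t y : is_tableau nu t -> gsupp (lowSym N m) y ->
  (forall q, q \in colg t -> gdelta q * y = eps C true q *: y) ->
  (forall p, p \in rowg t -> y * gdelta p = y) -> y = y 1%g *: ysym t.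
Proof.
move=> tt /gsuppP sy yl yr; apply/gringP => h; rewrite gringZE.
have ylE q g : q \in colg t -> y (q * g)%g = eps C true q * y g.
  move=> qc; have := yl q qc => /(congr1 (fun x : A => x (q * g)%g)).
  rewrite gdelta_mulE gringZE mulKg => ->.
  by rewrite mulrA eps_sq mul1r.
have yrE p g : p \in rowg t -> y (g * p)%g = y g.
  move=> pr; have := yr p pr => /(congr1 (fun x : A => x (g * p)%g)).
  by rewrite gmul_deltaE mulgK.
have prod_case q p : q \in colg t -> p \in rowg t -> y (q * p)%g = y 1%g * ysym t (q * p)%g.
  by move=> qc pr; rewrite (ysym_in tt) // yrE // -[q]mulg1 ylE // mulg1 mulrC.
have [/existsP[q /existsP[p /and3P[qc pr /eqP->]]]|none] :=
    boolP [exists q, exists p, [&& q \in colg t, p \in rowg t & h == (q * p)%g]].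
  exact: prod_case.
rewrite ysym_notin ?mulr0; last first.
  move=> q p qc pr; apply: contra none => /eqP->.
  by apply/existsP; exists q; apply/existsP; exists p; rewrite qc pr eqxx.
have [Sh|/sy//] := boolP (h \in lowSym N m).
have Sh' : (h^-1)%g \in lowSym N m by rewrite groupV.
have [/existsP[i /existsP[j /and5P[lt_i lt_j iNj rij cij]]]|ncol] :=
    boolP (collision m t (fun k => t (h^-1%g k))).
  have pr := row_tperm lt_i lt_j rij.
  have qc : tperm (h^-1%g i) (h^-1%g j) \in colg t.
    by apply: col_tperm; rewrite ?(lowSym_lt _ Sh').
  have e : (h * tperm i j = tperm (h^-1 i) (h^-1 j) * h)%g.
    by rewrite -tpermJ /conjg invgK !mulgA mulgKV.
  have : y h = - y h.
    rewrite -{1}(yrE _ h pr) e ylE // /eps odd_tperm (inj_eq perm_inj) iNj.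
    by rewrite expr1 mulN1r.
  by move/eqP; rewrite -addr_eq0 -mulr2n mulrn_eq0 /= => /eqP.
(* Without a collision, the rows of t and the columns of t after h^-1 form a tableau. The p carrying
   t to it preserves the rows of t, and [h * p] preserves the columns, so h is a product of a column
   and a row permutation, which was excluded. *)
have [_ tm] := mixed_tableau le_mN tt (tableau_perm tt Sh') (leqnn _) ncol.
have [p Sp mE] := tableau_trans tt tm.
have pr : p \in rowg t.
  apply/presP; split=> [|k]; first by apply/lowSymP.
  have [lt_k|le_k] := ltnP k m; first by rewrite -mE.
  by move/lowSymP: Sp => ->.
have qc : (h * p)%g \in colg t.
  have /lowSymP hp1 : (h * p)%g \in lowSym N m by rewrite groupM.
  apply/presP; split=> // k; have [lt_k|le_k] := ltnP k m; last by rewrite hp1.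
  by rewrite permM -mE ?(lowSym_lt _ Sh) //= permK.
case/negP: none; apply/existsP; exists (h * p)%g; apply/existsP; exists (p^-1)%g.
by rewrite qc groupV pr mulgK eqxx.
Qed.

End YoungSymmetrizer.

Section YoungPairs.
Variables (C : numClosedFieldType) (N m : nat).
Hypothesis le_mN : (m <= N)%N.
Local Notation A := (gring C 'S_N).
Local Notation H := (lowSym N m).
Implicit Types (t u : 'I_N -> nat * nat) (nu la mu : intpartn m) (g h p q : 'S_N).
Implicit Types (x y : A).
Local Notation ysym := (ysym C m).
Local Notation colsum := (colsum C m).
Local Notation rowsum := (rowsum C m).

Lemma young_pair nu t : is_tableau nu t -> primitive_pair H (colsum t) (rowsum t).
Proof.
move=> tt; split.
- exact: gsupp_colsum.
- exact: gsupp_rowsum.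
- exact: gstar_ysum.
- exact: gstar_ysum.
- by exists #|colg m t|%:R; rewrite ?ysum_sq // ltr0n cardG_gt0.
- by exists #|rowg m t|%:R; rewrite ?ysum_sq // ltr0n cardG_gt0.
- exact: gtau_ysym tt.
move=> x sx; exists ((ysym t * x * ysym t) 1%g).
(* Primitivity: e x e inherits the column symmetry of its left factor and the row symmetry of its
   right factor. *)
rewrite -[_ * rowsum t]/(ysym t); apply: (ysym_unique le_mN tt).
- exact: gsuppM (gsuppM (gsupp_ysym _ _ _) sx) (gsupp_ysym _ _ _).
- move=> q qc; rewrite !(mulrA (gdelta q)). by rewrite gdelta_ysum // -!scalerAl.
- by move=> p pr; rewrite -mulrA ysymMr.
Qed.

Definition std (s : seq nat) : 'I_N -> nat * nat := fun k => nth (0%N, 0%N) (boxes s) k.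

Lemma std_tableau nu : is_tableau nu (std (val nu)).
Proof.
have sz : size (boxes (val nu)) = m by rewrite size_boxes partn_sum.
split=> [i j|k lt_k]; last by rewrite mem_nth ?sz.
rewrite !inE /std => lt_i lt_j e; apply/val_inj/eqP.
by rewrite -(nth_uniq (0%N, 0%N) _ _ (boxes_uniq (val nu))) ?sz // e.
Qed.

Definition yproj nu : A := gproj H (ysym (std (val nu))).
Definition ykappa nu : C := gkappa (ysym (std (val nu))).

Definition young_pair_std nu := young_pair (std_tableau nu).

Lemma yproj_ysym nu t : is_tableau nu t -> yproj nu * ysym t = ysym t.
Proof.
move=> tt; have [p Sp e] := tableau_trans le_mN (std_tableau nu) tt.
rewrite (eq_ysym C e) ysym_conj //; apply: gproj_conj => //.
exact: gproj_id (young_pair_std nu).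
Qed.

(** The transposition of i and j is absorbed by the row sum; moved across h, it changes the sign of
    the column sum. The product equals its own opposite. *)
Lemma row_col_collision t u h (i j : 'I_N) : (i < m)%N -> (j < m)%N -> i != j ->
  same_row t i j -> same_col u (h i) (h j) -> h \in H ->
  rowsum t * gdelta h * colsum u = 0.
Proof.
move=> lt_i lt_j iNj rij cij Sh.
have pr : tperm i j \in rowg m t by apply: row_tperm.
have qc : tperm (h i) (h j) \in colg m u by apply: col_tperm; rewrite ?(lowSym_lt _ Sh).
have e : (tperm i j * h = h * tperm (h i) (h j))%g.
  by rewrite -tpermJ /conjg mulKVg.
have e1 : rowsum t * gdelta (tperm i j) = rowsum t.
  by rewrite ysum_gdelta // /eps expr0 scale1r.
have e2 : gdelta (tperm (h i) (h j)) * colsum u = - colsum u.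
  by rewrite gdelta_ysum // /eps odd_tperm (inj_eq perm_inj) iNj expr1 scaleN1r.
have : rowsum t * gdelta h * colsum u = - (rowsum t * gdelta h * colsum u).
  rewrite -{1}e1; transitivity (rowsum t * gdelta (tperm i j * h) * colsum u).
    by rewrite gdeltaM !mulrA.
  by rewrite e gdeltaM -mulrN -e2 !mulrA.
set z := rowsum t * _ * _ => ez; have : z *+ 2 = 0 by rewrite mulr2n {1}ez addNr.
by rewrite -scaler_nat => /eqP; rewrite scaler_eq0 pnatr_eq0 => /eqP.
Qed.

(** The total column weight replaces the dominance order: being a number, it compares any two
    shapes, and the projections commute, so one direction suffices. There distinct shapes force a
    collision for every h. *)
Lemma yproj_orth la mu : la != mu -> yproj la * yproj mu = 0.
Proof.
suff {la mu} main la mu : la != mu ->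
    (\sum_(b <- boxes (val mu)) b.2 <= \sum_(b <- boxes (val la)) b.2)%N ->
    yproj la * yproj mu = 0.
  move=> laNmu; have [le_w|/ltnW le_w] := leqP (\sum_(b <- boxes (val mu)) b.2)%N
    (\sum_(b <- boxes (val la)) b.2)%N; first exact: main.
  rewrite gproj_comm; first by rewrite main // eq_sym.
  exact: gsupp_proj (young_pair_std mu).
move=> laNmu le_w; apply: gproj_orth => h Sh.
have [/existsP[i /existsP[j /and5P[lt_i lt_j iNj rij cij]]]|ncol] :=
    boolP (collision m (std (val la)) (fun k => std (val mu) (h k))).
  have -> : ysym (std (val la)) * gdelta h * ysym (std (val mu)) =
    colsum (std (val la)) * (rowsum (std (val la)) * gdelta h * colsum (std (val mu))) *
    rowsum (std (val mu)) by rewrite !mulrA.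
  by rewrite (row_col_collision lt_i lt_j iNj rij cij Sh) mulr0 mul0r.
have [e _] := mixed_tableau le_mN (std_tableau la) (tableau_perm (std_tableau mu) Sh) le_w ncol.
by rewrite e eqxx in laNmu.
Qed.

(** ** Class sums of transpositions *)

(** The sum is over ordered pairs, so each transposition occurs twice; this is the origin of the
    factors 2 below. *)
Definition tsum : A :=
  \sum_(i : 'I_N | (i < m)%N) \sum_(j : 'I_N | (j < m)%N && (j != i)) gdelta (tperm i j).

Lemma gsupp_tsum : gsupp H tsum.
Proof.
apply: gsupp_sum => i lt_i; apply: gsupp_sum => j /andP[lt_j _].
by rewrite gsupp_delta // tperm_lowSym.
Qed.

Lemma tsum_comm x : gsupp H x -> GRing.comm tsum x.
Proof.
apply: comm_gsupp => g Sg; have Sg' : (g^-1)%g \in H by rewrite groupV.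
rewrite /GRing.comm /tsum mulr_suml mulr_sumr.
rewrite (reindex_inj (@perm_inj _ g^-1%g)) /=.
apply: eq_big => [i|i lt_i]; first by rewrite (lowSym_lt _ Sg').
rewrite mulr_suml mulr_sumr (reindex_inj (@perm_inj _ g^-1%g)) /=.
apply: eq_big => [j|j _]; first by rewrite (lowSym_lt _ Sg') (inj_eq perm_inj).
by rewrite -!gdeltaM; congr gdelta; rewrite -tpermJ /conjg invgK !mulgA mulgKV.
Qed.

Lemma ysym_tperm nu t (i j : 'I_N) : is_tableau nu t -> (i < m)%N -> (j < m)%N -> j != i ->
  ysym t (tperm i j) = (same_row t i j)%:R - (same_col t i j)%:R.
Proof.
move=> tt lt_i lt_j jNi; have iNj : i != j by rewrite eq_sym.
have [rij|rij] := boolP (same_row t i j).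
  rewrite -[tperm i j]mul1g (ysym_in C tt) ?group1 ?row_tperm // eps1.
  case: (boolP (same_col t i j)) => [cij|_]; last by rewrite subr0.
  case/negP: iNj; apply/eqP; apply: tt.1 => //.
  by rewrite [LHS]surjective_pairing (eqP rij) (eqP cij) -surjective_pairing.
rewrite sub0r; have [cij|cij] := boolP (same_col t i j).
  rewrite -[tperm i j]mulg1 (ysym_in C tt) ?group1 ?col_tperm //.
  by rewrite /eps odd_tperm iNj expr1.
rewrite oppr0 ysym_notin // => q p /presP[q1 q2] /presP[p1 p2]; apply/eqP => e.
have pqE k : tperm i j k = p (q k) by rewrite e permM.
(* If the transposition is q followed by p, then q k lies in the column of k, and in its row because
   p sends q k back to k. Hence q moves at most i and j: exchanging them puts them in one column,
   fixing i leaves p to send i to j within a row. *)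
have q_fix (k : 'I_N) : k != i -> k != j -> (k < m)%N -> q k = k.
  move=> kNi kNj lt_k; have := pqE k; rewrite tpermD 1?eq_sym // => ek.
  have Sq : q \in H by apply/lowSymP.
  apply: tt.1; rewrite ?inE ?(lowSym_lt _ Sq) //.
  by rewrite [LHS]surjective_pairing q2 -[(t (q k)).1]p2 -ek -surjective_pairing.
have qi : q i = i \/ q i = j.
  have Sq : q \in H by apply/lowSymP.
  have lt_qi : (q i < m)%N by rewrite (lowSym_lt _ Sq).
  have [->|qiNi] := eqVneq (q i) i; first by left.
  have [->|qiNj] := eqVneq (q i) j; first by right.
  by have /perm_inj/eqP := q_fix _ qiNi qiNj lt_qi; rewrite (negPf qiNi).
case: qi => qi; last by case/negP: cij; rewrite /same_col -qi q2.
by case/negP: rij; have := pqE i; rewrite qi tpermL /same_row => ->; rewrite p2.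
Qed.

(** The eigenvalue is the trace of the class sum against the symmetrizer: ordered pairs in a common
    row minus ordered pairs in a common column. These numbers are twice the sums of the column and
    of the row indices. *)
Lemma tsum_yproj nu :
  tsum * yproj nu = (2 * (\sum_(b <- boxes (val nu)) content b)%:~R) *: yproj nu.
Proof.
have tt := std_tableau nu; set t := std _ in tt.
rewrite (gproj_central (young_pair_std nu) gsupp_tsum); last first.
  by move=> g Sg; apply/tsum_comm/gsupp_delta.
congr (_ *: _); rewrite /tsum mulr_suml linear_sum /=.
have term (i j : 'I_N) : (i < m)%N -> (j < m)%N && (j != i) ->
    gtau (gdelta (tperm i j) * ysym t) = (same_row t i j)%:R - (same_col t i j)%:R.
  move=> lt_i /andP[lt_j jNi].
  by rewrite gtauC gtau_mul_delta tpermV (ysym_tperm tt).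
transitivity (\sum_(i : 'I_N | (i < m)%N) \sum_(j : 'I_N | (j < m)%N && (j != i))
    ((same_row t i j)%:R - (same_col t i j)%:R) : C).
  apply: eq_bigr => i lt_i; rewrite mulr_suml linear_sum /=.
  by apply: eq_bigr => j; apply: term.
have dbl (r : rel 'I_N) (u : 'I_N -> nat) : symmetric r ->
    {in [pred k : 'I_N | k < m]%N &, forall k k', r k k' -> u k = u k' -> k = k'} ->
    \sum_(i : 'I_N | (i < m)%N) \sum_(j : 'I_N | (j < m)%N && (j != i)) (r i j)%:R =
    2 * (inversions [pred k : 'I_N | k < m]%N r u)%:R :> C.
  move=> r_sym u_inj; rewrite -natrM mul2n (inversions_double r_sym u_inj) natr_sum.
  apply: eq_bigr => i _; rewrite natr_sum big_mkcondr; apply: eq_bigr => j _.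
  by case: (j != i); rewrite ?andbT ?andbF.
transitivity (
   \sum_(i : 'I_N | (i < m)%N) \sum_(j : 'I_N | (j < m)%N && (j != i)) (same_row t i j)%:R -
   \sum_(i : 'I_N | (i < m)%N) \sum_(j : 'I_N | (j < m)%N && (j != i)) (same_col t i j)%:R : C).
  rewrite -sumrB; apply: eq_bigr => i _; by rewrite -sumrB.
rewrite (dbl _ (fun k => (t k).2)); [|by move=> i j; rewrite /same_row eq_sym
  |exact: tableau_inj_row tt].
rewrite (dbl _ (fun k => (t k).1)); [|by move=> i j; rewrite /same_col eq_sym
  |exact: tableau_inj_col tt].
rewrite (inversions_row le_mN tt) (inversions_col le_mN tt) -mulrBr; congr (2 * _).
by rewrite /content sumrB rmorphB /= !rmorph_sum.
Qed.

End YoungPairs.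

(** * The branching rule *)

Section UpDown.
Variables (C : numClosedFieldType).

Definition down_sum m (F : intpartn m -> C) (nu : intpartn m.+1) : C :=
  \sum_(beta : intpartn m | adds_box (val beta) (val nu)) F beta.
Definition up_sum m (F : intpartn m.+1 -> C) (beta : intpartn m) : C :=
  \sum_(nu : intpartn m.+1 | adds_box (val beta) (val nu)) F nu.

Lemma up_down_sum m (F : intpartn m.+1 -> C) beta :
  up_sum (down_sum F) beta = F beta + down_sum (up_sum F) beta.
Proof.
have card_sum k (p q : pred (intpartn k)) :
    \sum_(nu | p nu) (q nu)%:R = #|[set nu | p nu && q nu]|%:R :> C.
  rewrite -sum1_card natr_sum [RHS]big_mkcond [LHS]big_mkcond.
  by apply: eq_bigr => nu _; rewrite inE; case: (p nu) (q nu) => [] [].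
transitivity (\sum_(beta' : intpartn m.+1) #|[set nu : intpartn m.+2 |
    adds_box (val beta) (val nu) && adds_box (val beta') (val nu)]|%:R * F beta').
  rewrite /up_sum /down_sum.
  under eq_bigr => nu _ do rewrite big_mkcond.
  rewrite exchange_big; apply: eq_bigr => beta' _.
  rewrite -card_sum mulr_suml; apply: eq_bigr => nu _.
  by case: ifP => _; rewrite ?mul1r ?mul0r.
transitivity (\sum_(beta' : intpartn m.+1) #|[set gamma : intpartn m |
    adds_box (val gamma) (val beta) && adds_box (val gamma) (val beta')]|%:R * F beta'
    + \sum_(beta' : intpartn m.+1) (beta == beta')%:R * F beta').
  rewrite -big_split; apply: eq_bigr => beta' _ /=.
  by rewrite card_up_down natrD mulrDl.
rewrite addrC; congr (_ + _).
  rewrite (bigD1 beta) //= eqxx mul1r big1 ?addr0 // => beta' /negPf.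
  by rewrite eq_sym => ->; rewrite mul0r.
rewrite /up_sum /down_sum.
under [RHS]eq_bigr => nu _ do rewrite big_mkcond.
rewrite [RHS]exchange_big; apply: eq_bigr => beta' _.
rewrite -card_sum mulr_suml; apply: eq_bigr => nu _.
by case: ifP => _; rewrite ?mul1r ?mul0r.
Qed.

Lemma sum_down_sum m (F : intpartn m -> C) (G : intpartn m.+1 -> C) :
  \sum_nu G nu * down_sum F nu = \sum_beta F beta * up_sum G beta.
Proof.
rewrite /up_sum /down_sum.
under eq_bigr => nu _ do rewrite mulr_sumr big_mkcond.
rewrite exchange_big; apply: eq_bigr => beta _ /=.
rewrite mulr_sumr [RHS]big_mkcond; apply: eq_bigr => nu _.
by case: ifP => _; rewrite // mulrC.
Qed.

Lemma intpartn0_unique (nu nu' : intpartn 0) : nu = nu'.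
Proof. by apply: partn_inj => i; rewrite !partn_nth0. Qed.

Lemma up_down_sum0 (F : intpartn 0 -> C) beta : up_sum (down_sum F) beta = F beta.
Proof.
transitivity (\sum_(nu in [set nu : intpartn 1 | adds_box (val beta) (val nu)]) F beta).
  apply: eq_big => nu; first by rewrite inE.
  move=> add_nu; rewrite /down_sum (bigD1 beta) //= big1 ?addr0 // => beta' /andP[_].
  by rewrite (intpartn0_unique beta' beta) eqxx.
by rewrite sumr_const (@card_up 1) // big_ord_recl big_ord0.
Qed.

End UpDown.

(** * Restriction multiplicities and dimensions *)

Section Branching.
Variables (C : numClosedFieldType) (N : nat).
Local Notation A := (gring C 'S_N).
Local Notation H m := (lowSym N m).

Lemma add_box_tableau m (beta : intpartn m) (nu : intpartn m.+1) :
  (m.+1 <= N)%N -> adds_box (val beta) (val nu) ->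
  exists2 t, @is_tableau N m.+1 nu t & forall k : 'I_N, (k < m)%N -> t k = std (val beta) k.
Proof.
move=> le_mN add_nu; have [b bE] : exists b, skew_boxes (val nu) (val beta) = [:: b].
  by case/andP: add_nu => _; case: skew_boxes => [//|b [|]//] _; exists b.
have : b \in skew_boxes (val nu) (val beta) by rewrite bE mem_head.
rewrite mem_filter => /andP[b_notin b_in].
have [s_inj s_in] := std_tableau N beta.
exists (fun k : 'I_N => if (k < m)%N then std (val beta) k else b) => [|k ->] //.
have eq_m (k : 'I_N) : (k < m.+1)%N -> ~~ (k < m)%N -> k = m :> nat by lia.
split=> [i j|k _].
  rewrite !inE => lt_i lt_j; case: ifPn => li; case: ifPn => lj.
  - exact: s_inj.
  - by move=> e; rewrite -e s_in in b_notin.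
  - by move=> e; rewrite e s_in in b_notin.
  - by move=> _; apply: val_inj; rewrite /= (eq_m i) // (eq_m j).
case: ifP => // lt_k; case/andP: add_nu => /allP sub _.
exact/sub/s_in.
Qed.

Lemma pres_succ m f (g : 'S_N) :
  g \in pres m f = (g \in pres m.+1 f) && [forall k : 'I_N, (k == m :> nat) ==> (g k == k)].
Proof.
apply/presP/andP => [[g1 g2]|[/presP[g1 g2] /forallP g3]]; split=> //.
- by apply/presP; split=> // k /ltnW/g1.
- by apply/forallP => k; apply/implyP => /eqP e; rewrite g1 // e.
- move=> k; rewrite leq_eqVlt => /orP[/eqP e|/g1//].
  by have := g3 k; rewrite -e eqxx => /eqP.
Qed.

(** If a product of a column and a row permutation fixes the entry m, each factor fixes it: its
    image under q shares its column, and shares its row since p brings it back. *)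
Lemma gres_ysym m (beta : intpartn m) (nu : intpartn m.+1) (t : 'I_N -> nat * nat) :
  (m < N)%N -> is_tableau beta t -> is_tableau nu t ->
  gres (H m) (ysym C m.+1 t) = ysym C m t.
Proof.
move=> lt_mN tb tn; apply/gringP => g; rewrite gresE; case: ifPn => [Sg|gNS]; last first.
  by move/gsuppP: (gsupp_ysym C m t) => ->.
have [/existsP[q /existsP[p /and3P[qc pr /eqP e]]]|none] :=
    boolP [exists q, exists p, [&& q \in colg m t, p \in rowg m t & g == (q * p)%g]].
  rewrite e (ysym_in C tb) // (ysym_in C tn) //.
    by move: qc; rewrite [_ \in _]pres_succ => /andP[].
  by move: pr; rewrite [_ \in _]pres_succ => /andP[].
rewrite !ysym_notin // => q p qc pr; apply: contra none => /eqP e.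
  by apply/existsP; exists q; apply/existsP; exists p; rewrite qc pr e eqxx.
have fix_last (k : 'I_N) : k = m :> nat -> q k = k /\ p k = k.
  move=> km; have /lowSymP g1 := Sg; have gk : p (q k) = k by rewrite -permM -e g1 // km.
  have Sq : q \in H m.+1 by apply: (fintype.subsetP (pres_sub _ _) _ qc).
  have /presP[_ q2] := qc; have /presP[_ p2] := pr.
  have qk : q k = k.
    apply: tn.1; rewrite ?inE ?(lowSym_lt _ Sq) ?km //.
    by rewrite [LHS]surjective_pairing q2 -p2 gk -surjective_pairing.
  by split=> //; rewrite -{1}qk.
apply/existsP; exists q; apply/existsP; exists p; rewrite e eqxx andbT.
rewrite [q \in _]pres_succ [p \in _]pres_succ qc pr /=.
by apply/andP; split; apply/forallP => k; apply/implyP => /eqP/fix_last[qk pk];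
  rewrite ?qk ?pk.
Qed.

(** Take a tableau of shape nu that extends one of shape beta. If the product vanished, so would
    P_beta times its symmetrizer; but restricting that element to S_m gives the symmetrizer for
    beta, of trace 1. *)
Lemma yproj_mul_neq0 m (beta : intpartn m) (nu : intpartn m.+1) : (m < N)%N ->
  adds_box (val beta) (val nu) -> yproj C N nu * yproj C N beta != 0.
Proof.
move=> lt_mN add_nu; have le_mN := ltnW lt_mN.
have [t tn tb] := add_box_tableau lt_mN add_nu.
have tt : is_tableau beta t.
  have [s_inj s_in] := std_tableau N beta; split=> [i j lt_i lt_j|k lt_k].
    by rewrite !tb //; apply: s_inj.
  by rewrite tb // s_in.
have Sb : gsupp (H m) (yproj C N beta) by apply: gsupp_proj (young_pair_std C le_mN beta).
apply/eqP => PP0.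
have PP0' : yproj C N beta * yproj C N nu = 0.
  by rewrite -[LHS]gproj_comm ?PP0 //; apply: gsuppS Sb; apply: lowSym_sub.
have : gres (H m) (yproj C N beta * ysym C m.+1 t) = 0.
  by rewrite -(yproj_ysym C lt_mN tn) mulrA PP0' mul0r raddf0.
rewrite gresMl // (gres_ysym lt_mN tt tn) (yproj_ysym C le_mN tt) => e0.
by have := gtau_ysym C tt; rewrite e0 raddf0 => /eqP; rewrite eq_sym oner_eq0.
Qed.

(** The multiplicity of S^beta in S^nu, rescaled by [ykappa beta / ykappa nu]. *)
Definition ymult m (beta : intpartn m) (nu : intpartn m.+1) : C :=
  gtau (yproj C N nu * ysym C m (std (val beta))).

(** The dimension of S^nu, [ykappa] being the product of the hook lengths. *)
Definition ydim m (nu : intpartn m) : C := m`!%:R / ykappa C N nu.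

Section Step.
Variable m : nat.
Hypothesis le_mN : (m <= N)%N.
Implicit Types nu : intpartn m.

Lemma ykappa_gt0 nu : 0 < ykappa C N nu.
Proof. exact: pp_kappa_gt0 (young_pair_std C le_mN nu). Qed.

Lemma gtau_yproj nu : gtau (yproj C N nu) = ydim nu / ykappa C N nu.
Proof.
rewrite (gtau_proj (young_pair_std C le_mN nu)) card_lowSym //.
by rewrite /ydim expr2 invfM mulrA.
Qed.

Lemma ydim_sq nu : ydim nu ^+ 2 = m`!%:R * gtau (yproj C N nu).
Proof. by rewrite gtau_yproj /ydim; field; rewrite gt_eqF ?ykappa_gt0. Qed.

Lemma ydim_gt0 nu : 0 < ydim nu.
Proof. by rewrite divr_gt0 ?ykappa_gt0 // ltr0n fact_gt0. Qed.

Lemma yproj_sum_idem :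
  (\sum_(nu : intpartn m) yproj C N nu) * (\sum_(nu : intpartn m) yproj C N nu) =
    \sum_(nu : intpartn m) yproj C N nu.
Proof.
rewrite mulr_suml; apply: eq_bigr => nu _; rewrite mulr_sumr (bigD1 nu) //=.
rewrite (gproj_idem (young_pair_std C le_mN nu)) big1 ?addr0 // => mu muNnu.
by rewrite yproj_orth // eq_sym.
Qed.

Lemma gstar_yproj_sum :
  gstar (\sum_(nu : intpartn m) yproj C N nu) = \sum_(nu : intpartn m) yproj C N nu.
Proof.
rewrite raddf_sum /=; apply: eq_bigr => nu _.
exact: gstar_proj (young_pair_std C le_mN nu).
Qed.

Let S := \sum_(nu : intpartn m) yproj C N nu.

Lemma star_compl : gstar (1 - S) = 1 - S.
Proof. by rewrite raddfB /= gstar_yproj_sum gone gstar_delta invg1. Qed.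
Lemma compl_idem : (1 - S) * (1 - S) = 1 - S.
Proof. by rewrite mulrBl !mulrBr !mul1r mulr1 yproj_sum_idem subrr subr0. Qed.

Lemma sum_ydim_sq_le : \sum_(nu : intpartn m) ydim nu ^+ 2 <= m`!%:R.
Proof.
under eq_bigr => nu _ do rewrite ydim_sq.
rewrite -mulr_sumr -[X in _ <= X]mulr1 ler_pM2l ?ltr0n ?fact_gt0 //.
have := gtau_proj_ge0 star_compl compl_idem.
by rewrite raddfB /= gtau1 subr_ge0 raddf_sum.
Qed.

Lemma yproj_complete : \sum_(nu : intpartn m) ydim nu ^+ 2 = m`!%:R <-> S = 1.
Proof.
have e : \sum_(nu : intpartn m) ydim nu ^+ 2 = m`!%:R * gtau S.
  by under eq_bigr => nu _ do rewrite ydim_sq; rewrite -mulr_sumr raddf_sum.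
have f0 : m`!%:R != 0 :> C by rewrite pnatr_eq0 -lt0n fact_gt0.
rewrite e; split=> [|->]; last by rewrite gtau1 mulr1.
rewrite -[X in _ = X]mulr1 => /(mulfI f0) tS.
apply/eqP; rewrite eq_sym -subr_eq0; apply: contraT => /gtau_star_gt0.
by rewrite star_compl compl_idem raddfB /= gtau1 tS subrr ltxx.
Qed.

End Step.

Definition ycomplete m := \sum_(nu : intpartn m) yproj C N nu = 1.

Section Induction.
Variable m : nat.
Hypothesis lt_mN : (m < N)%N.
Let le_mN := ltnW lt_mN.
Implicit Types (beta : intpartn m) (nu : intpartn m.+1).
Hypothesis compl_m : ycomplete m.
Hypothesis up_m : forall beta, up_sum (down_sum (@ydim m)) beta = m.+1%:R * ydim beta.

Let ppn nu := young_pair_std C lt_mN nu.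
Let ppb beta := young_pair_std C le_mN beta.
Let sHH : H m \subset H m.+1. Proof. exact: lowSym_sub. Qed.

Lemma ymult_ge beta nu : adds_box (val beta) (val nu) ->
  ykappa C N beta / ykappa C N nu <= ymult beta nu.
Proof.
by move=> add_nu; apply: (gmult_ge sHH (ppn nu) (ppb beta)); apply: yproj_mul_neq0.
Qed.

Lemma ymult_ge0 beta nu : 0 <= ymult beta nu.
Proof. exact: (gmult_ge0 sHH (ppn nu) (ppb beta)). Qed.

(** Up to the positive factor [ykappa beta], the amount by which the multiplicity exceeds the value
    0 or 1 predicted by the branching rule. *)
Let excess beta nu := ykappa C N nu * ymult beta nu -
  (adds_box (val beta) (val nu))%:R * ykappa C N beta.

Lemma excess_ge0 beta nu : 0 <= excess beta nu.
Proof.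
rewrite /excess; case: (boolP (adds_box _ _)) => [/ymult_ge|_].
  by rewrite mul1r subr_ge0 ler_pdivrMr ?(ykappa_gt0 lt_mN) // mulrC.
by rewrite mul0r subr0 mulr_ge0 ?ymult_ge0 // ltW ?(ykappa_gt0 lt_mN).
Qed.

Lemma ydim_excess nu :
  ydim nu = down_sum (@ydim m) nu + \sum_beta excess beta nu * gtau (yproj C N beta).
Proof.
have kN0 : ykappa C N nu != 0 by rewrite gt_eqF ?(ykappa_gt0 lt_mN).
transitivity (\sum_beta ykappa C N nu * ymult beta nu * gtau (yproj C N beta)).
  transitivity (ykappa C N nu * gtau (yproj C N nu)).
    by rewrite (gtau_yproj lt_mN) mulrC divfK.
  rewrite -[X in gtau X]mulr1 -compl_m mulr_sumr raddf_sum mulr_sumr.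
  apply: eq_bigr => beta _; rewrite -mulrA; congr (_ * _).
  exact: (gtau_gprojM _ _ sHH (ppb beta)).
rewrite /down_sum [X in X + _]big_mkcond -big_split; apply: eq_bigr => beta _ /=.
have e : ydim beta = ykappa C N beta * gtau (yproj C N beta).
  by rewrite (gtau_yproj le_mN) mulrC divfK // gt_eqF ?(ykappa_gt0 le_mN).
by rewrite /excess e; case: ifP => _ /=; ring.
Qed.

Lemma down_sum_le nu : 0 <= down_sum (@ydim m) nu <= ydim nu.
Proof.
rewrite sumr_ge0 => [|beta _]; last exact/ltW/(ydim_gt0 le_mN).
rewrite ydim_excess lerDl sumr_ge0 // => beta _.
by rewrite mulr_ge0 ?excess_ge0 // ltW ?(gtau_proj_gt0 (ppb beta)).
Qed.

(** The up and down operators are adjoint, so the squared norm of D d is the pairing of d with U D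
    d, that is, m+1 times the squared norm m! of d. *)
Lemma sum_down_sum_sq : \sum_nu down_sum (@ydim m) nu ^+ 2 = m.+1`!%:R.
Proof.
under eq_bigr => nu _ do rewrite expr2.
rewrite sum_down_sum; under eq_bigr => beta _ do rewrite up_m mulrCA -expr2.
by rewrite -mulr_sumr (yproj_complete le_mN).2 // factS natrM.
Qed.

Lemma ydimS nu : ydim nu = down_sum (@ydim m) nu.
Proof.
have ge0 (nu' : intpartn m.+1) : 0 <= ydim nu' ^+ 2 - down_sum (@ydim m) nu' ^+ 2.
  by have /andP[d0 dle] := down_sum_le nu'; rewrite subr_ge0 lerXn2r ?nnegrE // (le_trans d0).
have : \sum_nu (ydim nu ^+ 2 - down_sum (@ydim m) nu ^+ 2) = 0.
  apply/eqP; rewrite eq_le sumr_ge0 ?andbT // sumrB sum_down_sum_sq subr_le0.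
  exact: sum_ydim_sq_le.
move/eqP; rewrite psumr_eq0 // => /allP/(_ nu); rewrite mem_index_enum => /(_ isT)/=.
have /andP[d0 dle] := down_sum_le nu.
by rewrite subr_eq0 eqrXn2 // ?(le_trans d0) // => /eqP.
Qed.

Lemma ycompleteS : ycomplete m.+1.
Proof.
apply/(yproj_complete lt_mN); rewrite -sum_down_sum_sq.
by apply: eq_bigr => nu _; rewrite ydimS.
Qed.

(** Once the dimension equals the sum over shapes below, the excesses weighted by positive traces
    add up to zero, so each of them vanishes. *)
Lemma ymultE beta nu :
  ymult beta nu = (adds_box (val beta) (val nu))%:R * (ykappa C N beta / ykappa C N nu).
Proof.
have := ydim_excess nu; rewrite ydimS => /eqP; rewrite addrC -subr_eq subrr eq_sym.
rewrite psumr_eq0 => [|beta' _]; last first.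
  by rewrite mulr_ge0 ?excess_ge0 // ltW ?(gtau_proj_gt0 (ppb beta')).
move=> /allP/(_ beta); rewrite mem_index_enum => /(_ isT)/=.
rewrite mulf_eq0 (gt_eqF (gtau_proj_gt0 (ppb beta))) orbF subr_eq0 => /eqP e.
have kN0 : ykappa C N nu != 0 by rewrite gt_eqF ?(ykappa_gt0 lt_mN).
by apply: (mulfI kN0); rewrite e; field.
Qed.

(** By commutation U D = 1 + D U; as the new dimensions are D applied to the old ones, D U
    multiplies them by m+1 by the induction hypothesis. *)
Lemma up_sumS nu : up_sum (down_sum (@ydim m.+1)) nu = m.+2%:R * ydim nu.
Proof.
rewrite up_down_sum -[m.+2]addn1 natrD mulrDl mul1r addrC; congr (_ + _).
rewrite ydimS /down_sum mulr_sumr; apply: eq_bigr => beta _.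
by rewrite -up_m; apply: eq_bigr => nu' _; rewrite ydimS.
Qed.

End Induction.

Lemma yproj0 (nu : intpartn 0) : ysym C 0 (@std N (val nu)) = 1 /\ yproj C N nu = 1.
Proof.
have tt := std_tableau N nu.
have H1 : H 0 = 1%G.
  apply/group_inj/setP => g; rewrite in_set1; apply/lowSymP/eqP => [g1|-> k _];
    last by rewrite perm1.
  by apply/permP => k; rewrite g1 ?perm1.
have e1 : ysym C 0 (@std N (val nu)) = 1.
  have := gsuppE (gsupp_ysym C 0 (@std N (val nu))); rewrite H1 big_set1.
  by rewrite -[X in X *: _]/(gtau _) (gtau_ysym C tt) scale1r.
split=> //; rewrite /yproj /gproj e1 H1 /gavg big_set1 invg1 /gkappa !mulr1 gtau1.
by rewrite expr1n invr1 scale1r.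
Qed.

Lemma ycomplete_up m : (m <= N)%N ->
  ycomplete m /\ forall beta, up_sum (down_sum (@ydim m)) beta = m.+1%:R * ydim beta.
Proof.
elim: m => [_|m IH lt_mN].
  split=> [|beta]; last by rewrite up_down_sum0 mul1r.
  have [nu _] : exists nu : intpartn 0, forall i, nth 0%N (val nu) i = 0%N.
    by apply: (@partn_of_fun 0 0 (fun=> 0%N)); rewrite ?big_ord0.
  rewrite /ycomplete (bigD1 nu) //= big1 ?addr0; first by case: (yproj0 nu).
  by move=> nu' /eqP; have := intpartn0_unique nu' nu.
have [compl_m up_m] := IH (ltnW lt_mN).
by split=> [|beta]; [apply: ycompleteS|apply: up_sumS].
Qed.

Lemma branching m (beta : intpartn m) (nu : intpartn m.+1) : (m < N)%N ->
  ymult beta nu = (adds_box (val beta) (val nu))%:R * (ykappa C N beta / ykappa C N nu).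
Proof.
by move=> lt_mN; have [cm um] := ycomplete_up (ltnW lt_mN); apply: ymultE.
Qed.

End Branching.

(** * The trace on a Specht module *)

Section SubmoduleTrace.
Variables (F : fieldType) (gT : finGroupType) (G : {group gT}) (n : nat).
Variables (rG : mx_representation F G n) (U : 'M[F]_n) (modU : mxmodule rG U).

(** P is any linear retraction onto the submodule. Factoring it through the inclusion and using
    cyclicity of the trace moves the computation to the ambient space. *)
Lemma mxtrace_submod (c : gT -> F) (P : 'M[F]_n) :
    (P <= U)%MS -> (forall m (v : 'M[F]_(m, n)), (v <= U)%MS -> v *m P = v) ->
  \tr (\sum_(g in G) c g *: submod_repr modU g) = \tr ((\sum_(g in G) c g *: rG g) *m P).
Proof.
move=> sPU PU; set X := \sum_(g in G) c g *: rG g.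
have -> : \sum_(g in G) c g *: submod_repr modU g = in_submod U (val_submod 1%:M *m X).
  rewrite mulmx_sumr linear_sum; apply: eq_bigr => g _.
  by rewrite -scalemxAr linearZ.
have sBX : (val_submod (1%:M : 'M_(\rank U)) *m X <= U)%MS.
  rewrite mulmx_sumr summx_sub // => g Gg; rewrite -scalemxAr scalemx_sub //.
  by rewrite mxmodule_trans ?val_submodP.
have PQB : P *m in_submod U 1%:M *m val_submod 1%:M = P.
  by rewrite -in_submodE -val_submodE in_submodK.
rewrite -(PU _ _ sBX) in_submodE.
move: (in_submod U 1%:M) (val_submod 1%:M) PQB => Q B PQB.
by rewrite -[B *m X *m P]mulmxA -[_ *m Q]mulmxA mxtrace_mulC -[_ *m Q]mulmxA
  -mulmxA PQB.
Qed.

End SubmoduleTrace.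

Section SpechtTrace.
Variables (C : numClosedFieldType) (n : nat).
Local Notation A := (gring C 'S_n).
Local Notation G := [set: 'S_n]%G.
Local Notation aG := (regular_repr C G).
Implicit Types (x y z : A) (nu : intpartn n).

Let index (g : 'S_n) : 'I_#|G| := gring_index G g.

Let indexK g : enum_val (index g) = g.
Proof. by rewrite gring_indexK ?inE. Qed.

Definition grow x : 'rV[C]_#|G| := \sum_(g : 'S_n) x g *: delta_mx 0 (index g).
Definition gop x : 'M[C]_#|G| := \sum_(g in G) x g *: aG g.

Lemma grow_is_linear : linear grow.
Proof.
move=> c x y; rewrite /grow scaler_sumr -big_split; apply: eq_bigr => g _ /=.
by rewrite gringDE gringZE scalerDl scalerA.
Qed.
HB.instance Definition _ := GRing.isLinear.Build C A 'rV[C]_#|G| *:%R grow grow_is_linear.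

Lemma growE x (g : 'S_n) : grow x 0 (index g) = x g.
Proof.
rewrite summxE (bigD1 g) //= mxE mxE !eqxx mulr1 big1 ?addr0 // => h hNg.
rewrite !mxE eqxx /=; case: eqP => [e|_]; last by rewrite mulr0.
by have := congr1 enum_val e; rewrite !indexK => e'; rewrite e' eqxx in hNg.
Qed.

Lemma grow_delta g : grow (gdelta g) = delta_mx 0 (index g).
Proof.
rewrite /grow (bigD1 g) //= gdeltaE eqxx scale1r big1 ?addr0 // => h /negPf hNg.
by rewrite gdeltaE hNg scale0r.
Qed.

Lemma grow_gop x y : grow x *m gop y = grow (x * y).
Proof.
rewrite {1}/grow mulmx_suml [x in RHS]gringE mulr_suml [RHS]linear_sum /=.
apply: eq_bigr => g _; rewrite [y in RHS]gringE mulr_sumr [RHS]linear_sum /gop mulmx_sumr /=.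
apply: eq_big => [h|h _]; first by rewrite inE.
rewrite -scalerAl -scalerAr -gdeltaM !linearZ /= grow_delta -!scalemxAl.
by rewrite -rowE rowK [enum_val _]indexK !scalerA mulrC.
Qed.

Definition gleft z : 'M[C]_#|G| := \matrix_i grow (z * gdelta (enum_val i)).

Lemma grow_left z x : grow x *m gleft z = grow (z * x).
Proof.
rewrite {1}/grow mulmx_suml [x in RHS]gringE mulr_sumr [RHS]linear_sum /=.
apply: eq_bigr => g _; rewrite -scalerAr [RHS]linearZ /= -scalemxAl -rowE rowK.
by rewrite indexK.
Qed.

(** The diagonal entry at a group element g is the coefficient of g in z g x; summing over g
    conjugates z by the whole group. *)
Lemma mxtrace_gop_left x z :
  \tr (gop x *m gleft z) = gtau (gavg [set: 'S_n] z * x).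
Proof.
rewrite /mxtrace (reindex (fun g : 'S_n => index g)) /=; last first.
  exists enum_val => [g _|i _]; first exact: indexK.
  by rewrite /index gring_valK.
rewrite mulr_suml linear_sum (reindex_inj invg_inj) /=.
apply: eq_big => [g|g _]; first by rewrite inE.
have -> : (gop x *m gleft z) (index g^-1) (index g^-1) =
  (grow (z * (gdelta g^-1 * x))) 0 (index g^-1).
  by rewrite -grow_left -grow_gop grow_delta -mulmxA -rowE [RHS]mxE.
by rewrite growE -gtau_mul_delta gtauC !mulrA.
Qed.

Lemma young_symmetrizerE nu : young_symmetrizer C nu = ysym C n (std (val nu)).
Proof.
have rowE0 : row_group nu = rowg n (std (val nu)).
  apply/setP => g; rewrite inE; apply/forallP/presP => [e|[_ e] k]; last exact/eqP/e.
  by split=> k; [rewrite leqNgt ltn_ord|apply/eqP/e].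
have colE0 : col_group nu = colg n (std (val nu)).
  apply/setP => g; rewrite inE; apply/forallP/presP => [e|[_ e] k]; last exact/eqP/e.
  by split=> k; [rewrite leqNgt ltn_ord|apply/eqP/e].
rewrite /young_symmetrizer rowE0 colE0 /ysym /colsum /rowsum /ysum.
apply/ffunP => g; rewrite mulr_suml gring_sumE sum_ffunE.
under eq_bigr => p _ do rewrite sum_ffunE.
rewrite exchange_big; apply: eq_bigr => q _; rewrite mulr_sumr gring_sumE.
apply: eq_bigr => p _; rewrite ffunE -scalerAl -scalerAr -gdeltaM gringZE gringZE.
by rewrite /eps expr0 mul1r !ffunE.
Qed.

(** In row vectors the Specht module is the right ideal generated by e, and left multiplication by
    e/k is a retraction onto it. The average of e/k is k P_nu, whence the factor [ykappa]. *)
Lemma specht_traceE nu x :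
  specht_trace nu x = ykappa C n nu * gtau (yproj C n nu * x).
Proof.
have pp := young_pair_std C (leqnn n) nu.
pose e : A := ysym C n (@std n (val nu)); pose k := ykappa C n nu.
have k0 : k != 0 by rewrite gt_eqF // (ykappa_gt0 C (leqnn n)).
have ee : e * e = k *: e := pp_sq pp.
pose L := gleft (k^-1 *: e).
have L_e y : grow (e * y) *m L = grow (e * y).
  by rewrite grow_left -scalerAl mulrA ee -scalerAl scalerA mulVf // scale1r.
have op_gop (c : 'S_n -> C) : \sum_(g in G) c g *: aG g = gop (finfun c).
  by apply: eq_bigr => g _; rewrite ffunE.
rewrite /specht_trace /gaop /specht_repr young_symmetrizerE.
have modU := cyclic_mx_module aG (grow e).
transitivity (\tr (\sum_(g in G) x g *: submod_repr modU g)).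
  by congr (\tr _); apply: eq_big => [g|g _]; rewrite ?inE.
have gop_delta g : gop (gdelta g) = aG g.
  rewrite /gop (bigD1 g) ?inE //= gdeltaE eqxx scale1r big1 ?addr0 // => h /andP[_ /negPf hNg].
  by rewrite gdeltaE hNg scale0r.
rewrite (@mxtrace_submod _ _ _ _ _ _ modU x L).
- rewrite mxtrace_gop_left gavgZ; have := gprojE pp.
  rewrite lowSym_full => ->; rewrite scalerA -scalerAl linearZ /=.
  rewrite /yproj lowSym_full; congr (_ * _).
  by rewrite -/(ykappa C n nu) -/k expr2 mulKf.
- apply/row_subP => i; rewrite rowK -scalerAl linearZ scalemx_sub //=.
  rewrite -grow_gop gop_delta mxmodule_trans ?inE //.
  exact: cyclic_mx_id.
(* A row in the cyclic module has the form [grow (e * y)], which left multiplication by e/k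
   fixes. *)
move=> q v sv; apply/row_matrixP => i; rewrite row_mul.
have /cyclic_mxP[B /envelop_mxP[c ->] ->] : (row i v <= cyclic_mx aG (grow e))%MS.
  exact: submx_trans (row_sub i v) sv.
by rewrite op_gop grow_gop L_e.
Qed.

End SpechtTrace.

(** * Jucys-Murphy elements and the swap *)

Section JucysMurphy.
Variables (C : numClosedFieldType) (N : nat).
Local Notation A := (gring C 'S_N).
Local Notation H m := (lowSym N m).

Definition content_sum (s : seq nat) : int := \sum_(b <- boxes s) content b.

Definition jm (o : 'I_N) : A := \sum_(k : 'I_N | (k < o)%N) gdelta (tperm k o).

Lemma tsum_jm (o : 'I_N) : tsum C N o.+1 = tsum C N o + 2 *: jm o.
Proof.
rewrite /tsum (bigD1 o) //= addrC scaler_nat mulr2n addrA; congr (_ + _); last first.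
  apply: eq_big => [j|j _]; last by rewrite tpermC.
  by rewrite ltnS ltn_neqAle andbC.
have low (i : 'I_N) : (i < o.+1)%N && (i != o) = (i < o)%N by rewrite ltnS ltn_neqAle andbC.
rewrite (eq_bigl _ _ low) -big_split; apply: eq_bigr => i lt_i /=.
have iNo : o != i by rewrite -val_eqE /= gtn_eqF.
rewrite (bigD1 o) //= ?iNo ?ltnSn //= addrC; congr (_ + _).
by apply: eq_bigl => j; rewrite andbAC low.
Qed.

Section Level.
Variable o : 'I_N.
Let lt_o := ltn_ord o.
Let le_o := ltnW lt_o.
Variables (beta : intpartn o) (nu : intpartn o.+1).
Local Notation PP := (yproj C N nu * yproj C N beta).

Lemma gsupp_yproj m (la : intpartn m) : (m <= N)%N -> gsupp (H m) (yproj C N la).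
Proof. by move=> le_m; apply: gsupp_proj (young_pair_std C le_m la). Qed.

Lemma yproj_comm m (la : intpartn m) (x : A) : gsupp (H m) x -> yproj C N la * x = x * yproj C N la.
Proof. exact: gproj_comm. Qed.

Let gsupp_up (x : A) : gsupp (H o) x -> gsupp (H o.+1) x.
Proof. by apply: gsuppS; apply: lowSym_sub. Qed.

(** Twice the Jucys-Murphy element is the difference of the class sums of the two levels; the upper
    one acts through P_nu, the lower one through P_beta, each by twice a total content. *)
Lemma jm_mul : jm o * PP = (content_sum (val nu) - content_sum (val beta))%:~R *: PP.
Proof.
have two0 : 2 != 0 :> C by rewrite pnatr_eq0.
apply: (scalerI two0); rewrite scalerAl.
have -> : 2 *: jm o = tsum C N o.+1 - tsum C N o by rewrite tsum_jm addrC addKr.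
have e1 : tsum C N o.+1 * PP = (2 * (content_sum (val nu))%:~R) *: PP.
  by rewrite mulrA tsum_yproj // -scalerAl.
have e2 : tsum C N o * PP = (2 * (content_sum (val beta))%:~R) *: PP.
  rewrite mulrA -[_ * yproj C N nu]yproj_comm; last by apply: gsupp_up; apply: gsupp_tsum.
  by rewrite -mulrA tsum_yproj // -scalerAr.
by rewrite mulrBl e1 e2 -scalerBl -mulrBr scalerA rmorphB.
Qed.

Lemma mul_jm : PP * jm o = (content_sum (val nu) - content_sum (val beta))%:~R *: PP.
Proof.
rewrite -jm_mul; apply: (scalerI (_ : 2 != 0 :> C)); first by rewrite pnatr_eq0.
rewrite [LHS]scalerAr [RHS]scalerAl.
have -> : 2 *: jm o = tsum C N o.+1 - tsum C N o by rewrite tsum_jm addrC addKr.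
rewrite mulrBl mulrBr; congr (_ - _).
  have sPP : gsupp (H o.+1) PP.
    by apply: gsuppM; [apply: gsupp_yproj|apply: gsupp_up; apply: gsupp_yproj].
  exact: esym (tsum_comm sPP).
rewrite -mulrA [yproj C N beta * _]yproj_comm ?gsupp_tsum // !mulrA; congr (_ * _).
by apply: yproj_comm; apply: gsupp_up; apply: gsupp_tsum.
Qed.

Lemma yproj_mul_eq0 : ~~ adds_box (val beta) (val nu) -> PP = 0.
Proof.
move=> /negPf nadd.
have sub : H o \subset H o.+1 by apply: lowSym_sub.
apply: (gmult_eq0 sub (young_pair_std C lt_o nu) (young_pair_std C le_o beta)).
by have := branching C beta nu lt_o; rewrite nadd mul0r.
Qed.

(** The branching multiplicity contributes [ykappa beta / ykappa nu], whose denominator cancels the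
    factor of the Specht trace of nu; only the incidence of beta and nu remains. *)
Lemma yproj_trace (y : A) : gsupp (H o) y ->
  ykappa C N nu * gtau (PP * y) =
  (adds_box (val beta) (val nu))%:R * (ykappa C N beta * gtau (yproj C N beta * y)).
Proof.
move=> sy; have sub : H o \subset H o.+1 by apply: lowSym_sub.
rewrite (gtau_gprojM_res _ _ sub (young_pair_std C le_o beta) sy) mulrA.
have := branching C beta nu lt_o; rewrite /ymult => ->.
have kN0 : ykappa C N nu != 0 by rewrite gt_eqF // ykappa_gt0.
by rewrite -/(yproj C N beta); field.
Qed.

Lemma yprojM_idem : PP * PP = PP.
Proof.
have sub : H o \subset H o.+1 by apply: lowSym_sub.
exact: gproj_idemM sub (young_pair_std C lt_o nu) (young_pair_std C le_o beta).
Qed.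

Lemma gstar_yprojM : gstar PP = PP.
Proof.
have sub : H o \subset H o.+1 by apply: lowSym_sub.
exact: gstar_gprojM sub (young_pair_std C lt_o nu) (young_pair_std C le_o beta).
Qed.

End Level.
End JucysMurphy.

(** * The swap compressed to the projections of a branching path *)

Section Swap.
Variables (C : numClosedFieldType) (n : nat).
Local Notation N := n.+2.
Local Notation A := (gring C 'S_N).
Local Notation H m := (lowSym N m).
Local Notation P la := (yproj C N la).
Implicit Types (nu : intpartn n.+2) (beta : intpartn n.+1) (gamma : intpartn n).

Let o1 : 'I_N := Ordinal (leqnSn n.+1 : (n < N)%N).
Let o2 : 'I_N := ord_max.
Let s : A := gdelta (tperm o1 o2).

Lemma swap_jm : s * jm C o2 = jm C o1 * s + 1.
Proof.
have o12 : o1 != o2 by rewrite -val_eqE /= ltn_eqF.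
rewrite {1}/jm (bigD1 o1) //= mulrDr addrC -gdeltaM tperm2; congr (_ + _).
rewrite /jm mulr_sumr mulr_suml; apply: eq_big => [k|k /andP[lt_k kNo1]].
  by rewrite -val_eqE /=; lia.
have kNo2 : k != o2 by rewrite -val_eqE /= ltn_eqF.
rewrite -!gdeltaM; congr gdelta; rewrite [RHS]conjgC tpermJ tpermL tpermD //; by rewrite eq_sym.
Qed.

Lemma swap_comm x : gsupp (H n) x -> s * x = x * s.
Proof.
apply: comm_gsupp => g /lowSymP g1; rewrite /GRing.comm -!gdeltaM; congr gdelta.
by rewrite [LHS]conjgC tpermJ !g1.
Qed.

Lemma gsuppN (x : A) : gsupp (H N) x.
Proof. by rewrite lowSym_full gsuppT. Qed.

Section Triple.
Variables (nu : intpartn n.+2) (beta : intpartn n.+1) (gamma : intpartn n).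
Local Notation E := (P beta * P gamma).
Let c := content_sum (val nu) - content_sum (val beta).
Let c' := content_sum (val beta) - content_sum (val gamma).

Let Pnu_comm (x : A) : P nu * x = x * P nu.
Proof. by apply: yproj_comm; apply: gsuppN. Qed.

(* s X_N = X_(N-1) s + 1, compressed between E, where X_N and X_(N-1) act by
   the scalars c and c'. *)
Lemma swap_compress : (c - c')%:~R *: (P nu * (E * s * E)) = P nu * E :> A.
Proof.
have EE : E * E = E := yprojM_idem C (o := o1) gamma beta.
have jmE : jm C o2 * (P nu * E) = c%:~R *: (P nu * E).
  by rewrite !mulrA -[_ * _ * P beta]mulrA (jm_mul C (o := o2) beta nu) -!scalerAl.
have Ejm : E * jm C o1 = c'%:~R *: E := mul_jm C (o := o1) gamma beta.
have key : E * (s * jm C o2) * (P nu * E) = E * (jm C o1 * s + 1) * (P nu * E).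
  by rewrite swap_jm.
have EsE : E * s * (P nu * E) = P nu * (E * s * E).
  by rewrite [LHS]mulrA -[_ * P nu]Pnu_comm -[LHS]mulrA.
have EPE : E * (P nu * E) = P nu * E by rewrite mulrA -Pnu_comm -mulrA EE.
have lhs : E * (s * jm C o2) * (P nu * E) = c%:~R *: (P nu * (E * s * E)).
  transitivity (E * s * (jm C o2 * (P nu * E))); first by rewrite !mulrA.
  by rewrite jmE -scalerAr EsE.
have rhs : E * (jm C o1 * s + 1) * (P nu * E) = c'%:~R *: (P nu * (E * s * E)) + P nu * E.
  rewrite mulrDr mulr1 mulrDl EPE [E * (_ * s)]mulrA Ejm.
  by rewrite -[c'%:~R *: E * s]scalerAl -[_ *: _ * (P nu * E)]scalerAl EsE.
by rewrite rmorphB scalerBl -lhs key rhs addrC addKr.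
Qed.

Lemma swap_trace_term y : gsupp (H n.+1) y ->
  gtau (P nu * s * (E * y)) = (c - c')%:~R^-1 * gtau (P nu * E * y).
Proof.
move=> sy.
have PP : P beta * P beta = P beta := gproj_idem (young_pair_std C (leqnSn n.+1) beta).
have le_n : (n <= N)%N by rewrite ltnW.
have QQ : P gamma * P gamma = P gamma := gproj_idem (young_pair_std C le_n gamma).
have sQ : s * P gamma = P gamma * s by apply: swap_comm; apply: gsupp_yproj.
have PQ : P beta * P gamma = P gamma * P beta.
  by apply: yproj_comm; apply: gsuppS (gsupp_yproj C gamma le_n); apply: lowSym_sub.
have Py : P beta * y = y * P beta by apply: yproj_comm.
(* E is brought to both sides of s by different means: P_gamma commutes with s, while P_beta
   commutes with y and returns to the left by cyclicity of the trace. *)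
have -> : gtau (P nu * s * (E * y)) = gtau (P nu * (E * s * E) * y).
  have e1 : s * (E * y) = P gamma * s * (P beta * y) * P beta.
    rewrite -[_ * P beta in RHS]mulrA -[P beta * y * P beta]mulrA -Py.
    by rewrite [P beta * (P beta * y)]mulrA PP PQ -sQ !mulrA.
  have e2 : E * s * E = E * s * P beta.
    have EQ : E * P gamma = E by rewrite -mulrA QQ.
    transitivity (E * (s * P gamma) * P beta); first by rewrite PQ !mulrA.
    by rewrite sQ [E * (_ * s)]mulrA EQ.
  transitivity (gtau (P nu * (P gamma * s * (P beta * y)) * P beta)).
    by rewrite -[_ * P beta in RHS]mulrA -e1 [in RHS]mulrA.
  by rewrite gtauC e2; congr gtau; rewrite mulrA -[_ * P nu]Pnu_comm !mulrA.
(* If the contents coincide, the compressed relation forces P_nu E = 0, and both sides vanish, the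
   inverse of 0 being 0. *)
have [c0|cN0] := eqVneq (c - c') 0; last first.
  have cN0' : (c - c')%:~R != 0 :> C by rewrite intr_eq0.
  by rewrite -swap_compress -[_ *: _ * y]scalerAl linearZ /= mulKf.
have PE0 : P nu * E = 0 by rewrite -swap_compress c0 scale0r.
rewrite !mulrA -[P nu * P beta * P gamma]mulrA PE0 !mul0r raddf0.
by rewrite c0 invr0 mul0r.
Qed.

End Triple.

Definition swap_weight (beta : intpartn n.+1) (gamma : intpartn n) (a : A) : C :=
  ykappa C N beta * gtau (P beta * P gamma * (a * gstar a)).

(** E is a self-adjoint idempotent, so cyclicity doubles it and the weight becomes visibly
    nonnegative. *)
Lemma swap_weightE beta gamma a :
  swap_weight beta gamma a =
  ykappa C N beta * gtau (P beta * P gamma * a * gstar (P beta * P gamma * a)).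
Proof.
have EE : P beta * P gamma * (P beta * P gamma) = P beta * P gamma :=
  yprojM_idem C (o := o1) gamma beta.
have sE : gstar (P beta * P gamma) = P beta * P gamma := gstar_yprojM C (o := o1) gamma beta.
rewrite /swap_weight; congr (_ * _); rewrite [in RHS]gstarM sE.
move: (P beta * P gamma) EE => e ee.
have -> : e * a * (gstar a * e) = e * (a * gstar a) * e by rewrite !mulrA.
by rewrite [RHS]gtauC [in RHS]mulrA ee.
Qed.

Lemma swap_weight_ge0 beta gamma a : 0 <= swap_weight beta gamma a.
Proof. by rewrite swap_weightE mulr_ge0 ?gtau_star_ge0 // ltW // ykappa_gt0. Qed.

Lemma swap_weight_eq0 beta gamma a :
  ~~ adds_box (val gamma) (val beta) -> swap_weight beta gamma a = 0.
Proof.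
move=> nadd; have E0 : P beta * P gamma = 0 := yproj_mul_eq0 C (o := o1) nadd.
by rewrite /swap_weight E0 mul0r raddf0 mulr0.
Qed.

Lemma swap_weight_gt0 beta gamma : adds_box (val gamma) (val beta) ->
  0 < swap_weight beta gamma (P beta * P gamma).
Proof.
move=> add_g; rewrite swap_weightE mulr_gt0 ?ykappa_gt0 // gtau_star_gt0 //.
have -> : P beta * P gamma * (P beta * P gamma) = P beta * P gamma :=
  yprojM_idem C (o := o1) gamma beta.
exact: (yproj_mul_neq0 C (ltnW (ltnSn n.+1) : (n < N)%N) add_g).
Qed.

Lemma swap_weight_orth beta gamma beta' gamma' : (beta', gamma') != (beta, gamma) ->
  swap_weight beta' gamma' (P beta * P gamma) = 0.
Proof.
move=> neq; rewrite swap_weightE.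
have le_n : (n <= N)%N by rewrite ltnW.
have PQ (b : intpartn n.+1) (g : intpartn n) : P b * P g = P g * P b :> A.
  apply: yproj_comm; apply: gsuppS (gsupp_yproj C g le_n).
  exact: lowSym_sub.
suff -> : P beta' * P gamma' * (P beta * P gamma) = 0 by rewrite mul0r raddf0 mulr0.
have [eb|bN] := eqVneq beta' beta; last first.
  by rewrite {1}PQ -mulrA [P beta' * (P beta * _)]mulrA yproj_orth // mul0r mulr0.
have gN : gamma' != gamma by move: neq; rewrite eb xpair_eqE eqxx.
by rewrite [P beta * P gamma]PQ -mulrA [P gamma' * (P gamma * _)]mulrA yproj_orth // mul0r mulr0.
Qed.

(** Because P_nu is central, a and its star come together as y = a a*, an element of C[S_{n+1}].
    Inserting the two resolutions of the identity in front of y splits the trace along beta and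
    gamma. *)
Lemma specht_swap_trace (nu : intpartn n.+2) (a : A) : gsupp (H n.+1) a ->
  specht_trace nu (gstar a * s * a) =
  \sum_(beta : intpartn n.+1) \sum_(gamma : intpartn n)
    (adds_box (val beta) (val nu))%:R *
    ((content_sum (val nu) - content_sum (val beta)) -
     (content_sum (val beta) - content_sum (val gamma)))%:~R^-1 * swap_weight beta gamma a.
Proof.
move=> sa; rewrite specht_traceE.
have [cb _] := ycomplete_up C (leqnSn n.+1 : (n.+1 <= N)%N).
have [cg _] := ycomplete_up C (ltnW (ltnW (ltnSn n.+1)) : (n <= N)%N).
have sy : gsupp (H n.+1) (a * gstar a) by rewrite gsuppM ?gsupp_star.
have -> : gtau (P nu * (gstar a * s * a)) = gtau (P nu * s * (a * gstar a)).
  rewrite -mulrA mulrA (yproj_comm nu (gsuppN _)) -mulrA gtauC; congr gtau.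
  by rewrite !mulrA.
have -> : P nu * s * (a * gstar a) =
    \sum_(beta : intpartn n.+1) \sum_(gamma : intpartn n)
      P nu * s * (P beta * P gamma * (a * gstar a)).
  rewrite -{1}[a * gstar a]mul1r -cb mulr_suml mulr_sumr; apply: eq_bigr => beta _.
  rewrite -{1}[P beta]mulr1 -cg !(mulr_sumr, mulr_suml).
  by apply: eq_bigr => gamma _; rewrite !mulrA.
rewrite linear_sum mulr_sumr; apply: eq_bigr => beta _ /=.
rewrite linear_sum mulr_sumr; apply: eq_bigr => gamma _ /=.
rewrite swap_trace_term // mulrCA [RHS]mulrAC [RHS]mulrC; congr (_ * _).
have -> : P nu * (P beta * P gamma) * (a * gstar a) =
  P nu * P beta * (P gamma * (a * gstar a)) by rewrite !mulrA.
have sQy : gsupp (H n.+1) (P gamma * (a * gstar a)).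
  rewrite gsuppM //; have le_n : (n <= N)%N by rewrite ltnW.
  by apply: gsuppS (gsupp_yproj C gamma le_n); apply: lowSym_sub.
by rewrite (yproj_trace (o := o2) beta nu sQy) /swap_weight -[_ * (a * _) in RHS]mulrA.
Qed.

End Swap.

From mathcomp Require Import complex.
From mathcomp Require Import boolp classical_sets functions reals.

(** * Convex cones *)

Section Cones.
Variables (R : realType) (V : lmodType R).
Implicit Types (G : set V) (v w : V).
Local Open Scope classical_set_scope.

Lemma convex_cone0 G : convex_cone G 0.
Proof.
by exists 0%N, (fun=> 0), (fun=> 0); split=> [|[]|] //; rewrite big_ord0.
Qed.

Lemma convex_coneZ G c v : 0 <= c -> G v -> convex_cone G (c *: v).
Proof. by move=> c0 Gv; exists 1%N, (fun=> c), (fun=> v); split=> //; rewrite big_ord1. Qed.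

Lemma convex_coneD G v w : convex_cone G v -> convex_cone G w -> convex_cone G (v + w).
Proof.
move=> [k1 [c1 [g1 [c1_ge0 Gg1 ->]]]] [k2 [c2 [g2 [c2_ge0 Gg2 ->]]]].
exists (k1 + k2)%N,
  (fun i => match fintype.split i with inl j => c1 j | inr j => c2 j end),
  (fun i => match fintype.split i with inl j => g1 j | inr j => g2 j end).
split=> [i|i|]; [by case: fintype.split|by case: fintype.split|].
rewrite big_split_ord /=; congr (_ + _); apply: eq_bigr => i _.
  by rewrite (unsplitK (inl _ i)).
by rewrite (unsplitK (inr _ i)).
Qed.

Lemma convex_cone_scale G c v : 0 <= c -> convex_cone G v -> convex_cone G (c *: v).
Proof.
move=> c0 [k [d [g [d_ge0 Gg ->]]]]; exists k, (fun i => c * d i), g; split=> //.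
  by move=> i; rewrite mulr_ge0.
by rewrite scaler_sumr; apply: eq_bigr => i _; rewrite scalerA.
Qed.

Lemma convex_cone_sum G (I : Type) (r : seq I) (P : pred I) (F : I -> V) :
  (forall i, P i -> convex_cone G (F i)) -> convex_cone G (\sum_(i <- r | P i) F i).
Proof. by move=> GF; apply: big_ind => //; [apply: convex_cone0|apply: convex_coneD]. Qed.

Lemma convex_cone_sub G G' : G `<=` convex_cone G' -> convex_cone G `<=` convex_cone G'.
Proof.
move=> sGG' _ [k [c [g [c_ge0 Gg ->]]]]; apply: convex_cone_sum => i _.
by apply: convex_cone_scale => //; apply: sGG'.
Qed.

End Cones.

(** * The two families of generators compared *)

Section Main.
Variables (R : realType) (n : nat).
Local Notation C := R[i].
Local Notation A := (galg C n.+2).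
Implicit Types (nu : intpartn n.+2) (beta : intpartn n.+1) (gamma : intpartn n).

Definition cone_weight beta gamma (a : A) : R := complex.Re (swap_weight beta gamma a).

(** In the order of [R[i]] a nonnegative number is real; this turns the weights into real
    coefficients and makes the traces real. *)
Lemma ge0_complexE (z : C) : 0 <= z -> z = (complex.Re z)%:C%C.
Proof. by case: z => x y; rewrite lecE /= => /andP[/eqP-> _]. Qed.

Lemma swap_traceE (a : A) nu : in_sub_galg a ->
  swap_trace a nu = (\sum_beta \sum_gamma
    cone_weight beta gamma a * witness_vector R beta gamma nu)%:C%C.
Proof.
move=> sa; have sa' : gsupp (lowSym n.+2 n.+1) a.
  apply/gsuppP => g gNS; apply/eqP; apply: contraR gNS => /sa g_max.
  apply/lowSymP => k le_k; have -> : k = ord_max; last exact: g_max.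
  by apply/val_inj/eqP; rewrite eqn_leq le_k /= -ltnS ltn_ord.
have o1E : inord n = Ordinal (leqnSn n.+1 : (n < n.+2)%N) :> 'I_n.+2.
  by apply: val_inj; rewrite /= inordK.
have := specht_swap_trace nu sa'; rewrite -o1E => e.
rewrite [LHS]e rmorph_sum; apply: eq_bigr => beta _ /=.
rewrite rmorph_sum; apply: eq_bigr => gamma _ /=.
rewrite /witness_vector rmorphM /= -ge0_complexE ?swap_weight_ge0 //.
(* [skew_content] is known to be a difference of content sums only when a box is added; for all
   other pairs the weight is zero. *)
have [addg|nadd] := boolP (adds_box (val gamma) (val beta)); last first.
  by rewrite swap_weight_eq0 // mulr0 mul0r.
case: ifP => [addb|_]; last by rewrite rmorph0 mul0r mul0r mulr0.
by rewrite div1r fmorphV rmorph_int !skew_contentE // [RHS]mulrC mul1r.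
Qed.

Lemma swap_vectorE (a : A) : in_sub_galg a ->
  swap_vector a = \sum_(beta : intpartn n.+1) \sum_(gamma : intpartn n
    | adds_box (val gamma) (val beta))
    cone_weight beta gamma a *: (witness_vector R beta gamma : intpartn n.+2 -> R^o).
Proof.
move=> sa; apply/funext => nu; rewrite /swap_vector swap_traceE //=.
rewrite fct_sumE; apply: eq_bigr => beta _; rewrite fct_sumE [RHS]big_mkcond /=.
apply: eq_bigr => gamma _; case: ifPn => // nadd.
by rewrite /cone_weight swap_weight_eq0 // mul0r.
Qed.

Lemma witness_in_cone beta gamma : adds_box (val gamma) (val beta) ->
  convex_cone [set swap_vector a | a in [set a : A | in_sub_galg a]]%classic
    (witness_vector R beta gamma : intpartn n.+2 -> R^o).
Proof.
move=> addg; pose a : gring C 'S_n.+2 := yproj C n.+2 beta * yproj C n.+2 gamma.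
have sa : in_sub_galg (a : A).
  move=> g; apply: contra_neqP => gN; apply/eqP.
  have : gsupp (lowSym n.+2 n.+1) a.
    have le_n : (n <= n.+2)%N by rewrite ltnW.
    apply: gsuppM (gsupp_yproj C beta (leqnSn n.+1)) _.
    by apply: gsuppS (gsupp_yproj C gamma le_n); apply: lowSym_sub.
  move/gsuppP => -> //; apply: contra_notN gN => /lowSymP; exact.
have w_gt0 : 0 < cone_weight beta gamma a.
  have := swap_weight_gt0 C addg; rewrite -/a ltcE => /andP[_].
  exact.
(* In the expansion for this filter every other weight vanishes by orthogonality, at the same or at
   the lower level, so dividing by the positive weight that remains gives the witness itself. *)
have -> : (witness_vector R beta gamma : intpartn n.+2 -> R^o) =
    (cone_weight beta gamma a)^-1 *: swap_vector a.
  rewrite swap_vectorE // (bigD1 beta) //= (bigD1 gamma) //= !big1 ?addr0.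
  - by rewrite scalerA mulVf ?scale1r // gt_eqF.
  - move=> beta' bN; rewrite big1 // => gamma' _.
    by rewrite /cone_weight swap_weight_orth ?scale0r // xpair_eqE negb_and bN.
  - move=> gamma' /andP[_ gN].
    by rewrite /cone_weight swap_weight_orth ?scale0r // xpair_eqE negb_and gN orbT.
apply: convex_coneZ; first by rewrite invr_ge0 ltW.
by exists (a : A).
Qed.

End Main.

Local Open Scope classical_set_scope.
Local Open Scope ring_scope.

Theorem theorem9p4 (R : realType) (n : nat) :
  (forall (a : galg R[i] n.+2) (nu : intpartn n.+2),
      in_sub_galg a -> complex.Im (swap_trace a nu) = 0) /\
  convex_cone
    [set swap_vector a | a in [set a : galg R[i] n.+2 | in_sub_galg a]]
  = convex_cone
      [set w : intpartn n.+2 -> R^o |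
         exists (beta : intpartn n.+1) (gamma : intpartn n),
           adds_box (val gamma) (val beta) /\ w = witness_vector R beta gamma].
Proof.
split=> [a nu sa|]; first by rewrite swap_traceE.
apply/seteqP; split; apply: convex_cone_sub; last first.
  by move=> _ [beta [gamma [addg ->]]]; apply: witness_in_cone.
move=> _ [a sa <-]; rewrite swap_vectorE //; apply: convex_cone_sum => beta _.
apply: convex_cone_sum => gamma addg; apply: convex_coneZ; last by exists beta, gamma.
have := swap_weight_ge0 beta gamma (a : gring R[i] 'S_n.+2).
by rewrite lecE => /andP[_].
Qed.
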